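(* Let $X=(X_q,X_p)$ be a vector field with components $X_q,X_p:\mathbb{R}^d\times\mathbb{C}^d\to\mathbb{C}^d$, $(q,p)\mapsto X_q(q,p),X_p(q,p)$. The nondifferentiable system of equations $$\frac{\Box q}{\Box t}=X_q(q,p),\qquad \frac{\Box p}{\Box t}=X_p(q,p)$$ is Hamiltonian if and only if the associated quantum differential operator $$O_{\Box,X}(q,p)=\begin{pmatrix}\frac{\Box q}{\Box t}-X_q(q,p)\\[2pt] \frac{\Box p}{\Box t}-X_p(q,p)\end{pmatrix}$$ has a self-adjoint Fréchet derivative with respect to the $L^2$ symplectic scalar product. In this case, the Hamiltonian is given by $$H(q,p)=\int_0^1\left[p\cdot X_q(\lambda q,\lambda p)-q\cdot X_p(\lambda q,\lambda p)\right]d\lambda .$$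
   Context: **Quantum derivative.** Let $d\ge1$, let $I\subset\mathbb{R}$ be open with $[a,b]\subset I$, $a<b$, and fix $\mu\in\{-1,1,0,-i,i\}$. For $f\in\mathcal{C}^0(I,\mathbb{R}^d)$ and $\epsilon>0$ put $d_\epsilon^-f(t)=\frac{f(t)-f(t-\epsilon)}{\epsilon}$, $d_\epsilon^+f(t)=\frac{f(t+\epsilon)-f(t)}{\epsilon}$ and $$\frac{\Box_\epsilon f}{\Box t}=\frac12\left[(d_\epsilon^+f+d_\epsilon^-f)+i\mu(d_\epsilon^+f-d_\epsilon^-f)\right].$$ For $f$ with values in $\mathbb{C}^d$, $\frac{\Box_\epsilon f}{\Box t}=\frac{\Box_\epsilon \mathrm{Re}(f)}{\Box t}+i\frac{\Box_\epsilon \mathrm{Im}(f)}{\Box t}$. Let $\mathcal{C}^0_{conv}$ be the subspace of those $g$ in the space $\mathcal{C}^0(I\times]0,1])$ of continuous (vector-valued) functions for which $\lim_{\epsilon\to0}g(t,\epsilon)$ exists for every $t\in I$; fix a complementary subspace $E$, so that $\mathcal{C}^0(I\times]0,1])=\mathcal{C}^0_{conv}\oplus E$, and let $\pi$ be the projection $g_{conv}+g_E\mapsto g_{conv}$. Put $\langle g\rangle(t)=\lim_{\epsilon\to0}\pi(g)(t,\epsilon)$ (for complex-valued functions $\pi$ is understood in the same way, via real and imaginary parts). The quantum derivative is $\frac{\Box f}{\Box t}=\left\langle\frac{\Box_\epsilon f}{\Box t}\right\rangle$. **Function spaces.** For $0<\alpha<1$, $H^\alpha(I,\mathbb{R}^d)$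 (resp. $H^\alpha(I,\mathbb{C}^d)$) is the set of continuous functions $f$ on $I$ that are $\alpha$-Hölderian at each $t\in I$: there exist $\epsilon,c>0$ such that $\|f(t)-f(t')\|\le c|t-t'|^\alpha$ for all $t'\in I$ with $|t-t'|\le\epsilon$. $H^\beta_0$ is the set of $h\in H^\beta$ with $h(a)=h(b)=0$. Fix $0<\alpha,\beta<1$ with $\alpha+\beta>1$. The arguments $(q,p)$ of $O_{\Box,X}$ range over $H^\alpha(I,\mathbb{R}^d)\times H^\alpha(I,\mathbb{C}^d)$ with $\frac{\Box q}{\Box t},\frac{\Box p}{\Box t}\in H^\alpha(I,\mathbb{C}^d)$. **Vector field.** $X_q,X_p$ are $\mathcal{C}^1$ in $(q,p)$; since $p$ is a complex variable, they are holomorphic in $p$ and $\partial/\partial p$ denotes the complex derivative; $\partial X_q/\partial q$, etc., are $d\times d$ complex Jacobian matrices. **Hamiltonian system.** The system is Hamiltonian if there is a function $H:\mathbb{R}^d\times\mathbb{C}^d\to\mathbb{C}$, differentiable with respect to $q$ and holomorphic with respect to $p$, with $X_q=\frac{\partial H}{\partial p}$ and $X_p=-\frac{\partial H}{\partial q}$; such an $H$ is a Hamiltonian of the system. The last part of the claim says that the displayed $H$ is one. The dot is the bilinear product $x\cdot y=\sum_i x_iy_i$. **Self-adjointness.** The Fréchet derivative of $O_{\Box,X}$ at $(q,p)$ along $(u,v)\in H_0^\beta(I,\mathbb{R}^d)\times H_0^\beta(I,\mathbb{C}^d)$ with $\frac{\Box u}{\Box t},\frac{\Box v}{\Box t}\in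 H^\alpha(I,\mathbb{C}^d)$ is $$DO_{\Box,X}(q,p)(u,v)=\begin{pmatrix}\frac{\Box u}{\Box t}-\frac{\partial X_q}{\partial q}u-\frac{\partial X_q}{\partial p}v\\[2pt] \frac{\Box v}{\Box t}-\frac{\partial X_p}{\partial q}u-\frac{\partial X_p}{\partial p}v\end{pmatrix}.$$ The $L^2$ symplectic scalar product is $\langle f,g\rangle_{L^2,J}=\int_a^b f(t)\cdot Jg(t)\,dt$ with $J=\begin{pmatrix}0&I_d\\-I_d&0\end{pmatrix}$, and the adjoint $A_J^*$ of an operator $A$ is characterized by $\langle A\cdot f,g\rangle_{L^2,J}=\langle A_J^*\cdot g,f\rangle_{L^2,J}$. With respect to it, the adjoint of $DO_{\Box,X}(q,p)$ is the operator $$DO^*_{\Box,X}(q,p)(u,v)=\begin{pmatrix}\frac{\Box u}{\Box t}+\left(\frac{\partial X_p}{\partial p}\right)^{\mathsf T}u-\left(\frac{\partial X_q}{\partial p}\right)^{\mathsf T}v\\[2pt] \frac{\Box v}{\Box t}-\left(\frac{\partial X_p}{\partial q}\right)^{\mathsf T}u+\left(\frac{\partial X_q}{\partial q}\right)^{\mathsf T}v\end{pmatrix},$$ all Jacobians being evaluated at $(q(t),p(t))$; this operator is taken here as the meaning of the adjoint. ''$O_{\Box,X}$ has a self-adjoint Fréchet derivative'' means $DO_{\Box,X}(q,p)(u,v)=DO^*_{\Box,X}(q,p)(u,v)$ for all $(q,p)\in H^\alpha(I,\mathbb{R}^d)\times H^\alpha(I,\mathbb{C}^d)$ with $\frac{\Box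 q}{\Box t},\frac{\Box p}{\Box t}\in H^\alpha(I,\mathbb{C}^d)$ and all $(u,v)\in H_0^\beta(I,\mathbb{R}^d)\times H_0^\beta(I,\mathbb{C}^d)$ with $\frac{\Box u}{\Box t},\frac{\Box v}{\Box t}\in H^\alpha(I,\mathbb{C}^d)$. *)

(* Defs.v *)
From HB Require Import structures.
From mathcomp Require Import all_boot all_order all_algebra.
From mathcomp Require Import all_classical all_reals all_analysis.
From mathcomp Require Import complex ring lra.

Set Implicit Arguments.
Unset Strict Implicit.
Unset Printing Implicit Defensive.

Import Order.TTheory GRing.Theory Num.Theory.
Import numFieldNormedType.Exports.

Local Open Scope classical_set_scope.
Local Open Scope ring_scope.
Local Open Scope complex_scope.

HB.instance Definition _ (R : realType) := NormedModule.copy R[i] R[i]^o.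

Section ComplexVectors.
Variables (R : realType) (m n : nat).

Definition mxRe (A : 'M[R[i]]_(m, n)) : 'M[R]_(m, n) := map_mx (@complex.Re R) A.
Definition mxIm (A : 'M[R[i]]_(m, n)) : 'M[R]_(m, n) := map_mx (@complex.Im R) A.
Definition cplx (A : 'M[R]_(m, n)) : 'M[R[i]]_(m, n) := map_mx (real_complex R) A.

End ComplexVectors.

Arguments mxRe {R m n}.
Arguments mxIm {R m n}.

Section QuantumDerivative.
Variables (R : realType) (d : nat).

Definition dminus (f : R -> 'cV[R]_d) (e t : R) : 'cV[R]_d :=
  e^-1 *: (f t - f (t - e)).
Definition dplus (f : R -> 'cV[R]_d) (e t : R) : 'cV[R]_d :=
  e^-1 *: (f (t + e) - f t).

Definition box_epsR (mu : R[i]) (f : R -> 'cV[R]_d) (e t : R) : 'cV[R[i]]_d :=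
  2^-1 *: (cplx (dplus f e t + dminus f e t)
           + ('i%C * mu) *: cplx (dplus f e t - dminus f e t)).

Definition box_epsC (mu : R[i]) (f : R -> 'cV[R[i]]_d) (e t : R) : 'cV[R[i]]_d :=
  box_epsR mu (mxRe \o f) e t + 'i%C *: box_epsR mu (mxIm \o f) e t.

(* For f defined on I only, the quotients make sense at (t, e) when t - e and
   t + e lie in I.  [step I t e] is e, truncated at half the distance from t to
   the complement of I (capped at 1), so that this holds on all of I x ]0, 1].
   If I is the whole line then [step I t e = e] there; in general, for fixed t in I,
   [step I t e = e] for e small (lemma [step_near]).  The truncated quotients are
   continuous on I x ]0, 1] (lemmas [box_epsR_cont], [box_epsC_cont]), and [mean]
   only depends on the values at (t, e) for e small (lemma [mean_germ]), so how
   they are truncated is immaterial to the quantum derivative. *)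
Definition room (I : set R) (t : R) : R :=
  sup [set r | 0 <= r <= 2 /\ forall s, `|s - t| < r -> I s] / 2.
Definition step (I : set R) (t e : R) : R := Num.min e (room I t).

(* Functions on I x ]0, 1] are represented by total functions of z = (t, e),
   of which only the values on I x ]0, 1] matter. *)
Definition slab (I : set R) : set (R * R) := I `*` `]0, 1]%classic.

Definition C0 (I : set R) : set (R * R -> 'cV[R]_d) :=
  [set g | {within slab I, continuous g}].
Definition C0conv (I : set R) : set (R * R -> 'cV[R]_d) :=
  [set g | C0 I g /\ forall t, I t -> cvg (g (t, e) @[e --> 0^'+])].

Definition complementary (I : set R) (E : set (R * R -> 'cV[R]_d)) : Prop :=
  [/\ E `<=` C0 I,
      E (fun=> 0) /\
        (forall (c : R) g h, E g -> E h -> E (fun z => c *: g z + h z)),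
      forall g, C0 I g -> exists gc gE,
        [/\ C0conv I gc, E gE & forall z, slab I z -> g z = gc z + gE z]
    & forall g, C0conv I g -> E g -> forall z, slab I z -> g z = 0].

Definition conv_part (I : set R) (E : set (R * R -> 'cV[R]_d))
    (g : R * R -> 'cV[R]_d) : R * R -> 'cV[R]_d :=
  get [set gc | C0conv I gc /\
                exists2 gE, E gE & forall z, slab I z -> g z = gc z + gE z].

Definition conv_partC (I : set R) (E : set (R * R -> 'cV[R]_d))
    (g : R * R -> 'cV[R[i]]_d) (z : R * R) : 'cV[R[i]]_d :=
  cplx (conv_part I E (mxRe \o g) z) + 'i%C *: cplx (conv_part I E (mxIm \o g) z).

Definition mean (I : set R) (E : set (R * R -> 'cV[R]_d))
    (g : R * R -> 'cV[R[i]]_d) (t : R) : 'cV[R[i]]_d :=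
  lim (conv_partC I E g (t, e) @[e --> 0^'+]).

Definition boxR I mu E (f : R -> 'cV[R]_d) : R -> 'cV[R[i]]_d :=
  mean I E (fun z => box_epsR mu f (step I z.1 z.2) z.1).
Definition boxC I mu E (f : R -> 'cV[R[i]]_d) : R -> 'cV[R[i]]_d :=
  mean I E (fun z => box_epsC mu f (step I z.1 z.2) z.1).

End QuantumDerivative.

(* On vectors, `|_| is the maximum norm; over R[i] its values are in R[i], whence
   the cast %:C. *)
Section FunctionSpaces.
Variables (R : realType) (d : nat).

Definition holderR (I : set R) (alpha : R) (f : R -> 'cV[R]_d) : Prop :=
  {within I, continuous f} /\
  forall t, I t -> exists e c : R, [/\ 0 < e, 0 < c &
    forall t', I t' -> `|t - t'| <= e ->
      `|f t - f t'| <= c * `|t - t'| `^ alpha].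

Definition holderC (I : set R) (alpha : R) (f : R -> 'cV[R[i]]_d) : Prop :=
  {within I, continuous f} /\
  forall t, I t -> exists e c : R, [/\ 0 < e, 0 < c &
    forall t', I t' -> `|t - t'| <= e ->
      `|f t - f t'| <= (c * `|t - t'| `^ alpha)%:C].

Definition holder0R (I : set R) (a b beta : R) (f : R -> 'cV[R]_d) : Prop :=
  [/\ holderR I beta f, f a = 0 & f b = 0].
Definition holder0C (I : set R) (a b beta : R) (f : R -> 'cV[R[i]]_d) : Prop :=
  [/\ holderC I beta f, f a = 0 & f b = 0].

End FunctionSpaces.

Section PartialDerivatives.
Variables (R : realType) (d : nat).
Implicit Types (F : 'cV[R]_d -> 'cV[R[i]]_d -> R[i])
  (X : 'cV[R]_d -> 'cV[R[i]]_d -> 'cV[R[i]]_d).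

Definition differentiable_q F : Prop := forall q p,
  differentiable (fun q' => complex.Re (F q' p)) q /\
  differentiable (fun q' => complex.Im (F q' p)) q.

(* Differentiability over the field R[i]. *)
Definition holomorphic_p F : Prop := forall q p, differentiable (F q) p.

Definition partial_q F (j : 'I_d) q p : R[i] :=
  ('D_(delta_mx j 0) (fun q' => complex.Re (F q' p)) q)
  +i* ('D_(delta_mx j 0) (fun q' => complex.Im (F q' p)) q).
Definition partial_p F (j : 'I_d) q p : R[i] := 'D_(delta_mx j 0) (F q) p.

Definition grad_q F q p : 'cV[R[i]]_d := \col_j partial_q F j q p.
Definition grad_p F q p : 'cV[R[i]]_d := \col_j partial_p F j q p.

Definition component X (i : 'I_d) : 'cV[R]_d -> 'cV[R[i]]_d -> R[i] :=
  fun q p => X q p i 0.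

Definition jac_q X q p : 'M[R[i]]_d := \matrix_(i, j) partial_q (component X i) j q p.
Definition jac_p X q p : 'M[R[i]]_d := \matrix_(i, j) partial_p (component X i) j q p.

(* C^1 in (q, p) and holomorphic in p: X and its first partial derivatives,
   real in q and complex in p, exist and are jointly continuous. *)
Definition C1_field X : Prop :=
  [/\ forall i, differentiable_q (component X i) /\ holomorphic_p (component X i),
      continuous (fun z : 'cV[R]_d * 'cV[R[i]]_d => X z.1 z.2),
      continuous (fun z : 'cV[R]_d * 'cV[R[i]]_d => jac_q X z.1 z.2)
    & continuous (fun z : 'cV[R]_d * 'cV[R[i]]_d => jac_p X z.1 z.2)].

End PartialDerivatives.

Section Hamiltonian.
Variables (R : realType) (d : nat).
Variables (Xq Xp : 'cV[R]_d -> 'cV[R[i]]_d -> 'cV[R[i]]_d).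

Definition is_hamiltonian_of (H : 'cV[R]_d -> 'cV[R[i]]_d -> R[i]) : Prop :=
  [/\ differentiable_q H, holomorphic_p H &
      forall q p, Xq q p = grad_p H q p /\ Xp q p = - grad_q H q p].

Definition hamiltonian_system : Prop := exists H, is_hamiltonian_of H.

Definition dotc (x y : 'cV[R[i]]_d) : R[i] := \sum_i x i 0 * y i 0.

Definition integral01 (f : R -> R[i]) : R[i] :=
  (\int[lebesgue_measure]_(l in `[0%R, 1%R]) complex.Re (f l))
  +i* (\int[lebesgue_measure]_(l in `[0%R, 1%R]) complex.Im (f l)).

Definition explicit_H (q : 'cV[R]_d) (p : 'cV[R[i]]_d) : R[i] :=
  integral01 (fun l => dotc p (Xq (l *: q) (l%:C *: p))
                       - dotc (cplx q) (Xp (l *: q) (l%:C *: p))).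

End Hamiltonian.

Section QuantumOperator.
Variables (R : realType) (d : nat) (I : set R) (mu : R[i]).
Variables (E : set (R * R -> 'cV[R]_d)).
Variables (Xq Xp : 'cV[R]_d -> 'cV[R[i]]_d -> 'cV[R[i]]_d).

Definition qop (q : R -> 'cV[R]_d) (p : R -> 'cV[R[i]]_d) (t : R) :
    'cV[R[i]]_(d + d) :=
  col_mx (boxR I mu E q t - Xq (q t) (p t)) (boxC I mu E p t - Xp (q t) (p t)).

(* The Frechet derivative of [qop] at (q, p) along (u, v); see [Dqop_derive]. *)
Definition Dqop (q : R -> 'cV[R]_d) (p : R -> 'cV[R[i]]_d)
    (u : R -> 'cV[R]_d) (v : R -> 'cV[R[i]]_d) (t : R) : 'cV[R[i]]_(d + d) :=
  col_mx
    (boxR I mu E u t - jac_q Xq (q t) (p t) *m cplx (u t)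
                     - jac_p Xq (q t) (p t) *m v t)
    (boxC I mu E v t - jac_q Xp (q t) (p t) *m cplx (u t)
                     - jac_p Xp (q t) (p t) *m v t).

(* The adjoint of [Dqop q p] for the symplectic product
   \int_a^b f . J g,  J = (0, 1; -1, 0). *)
Definition Dqop_adj (q : R -> 'cV[R]_d) (p : R -> 'cV[R[i]]_d)
    (u : R -> 'cV[R]_d) (v : R -> 'cV[R[i]]_d) (t : R) : 'cV[R[i]]_(d + d) :=
  col_mx
    (boxR I mu E u t + (jac_p Xp (q t) (p t))^T *m cplx (u t)
                     - (jac_p Xq (q t) (p t))^T *m v t)
    (boxC I mu E v t - (jac_q Xp (q t) (p t))^T *m cplx (u t)
                     + (jac_q Xq (q t) (p t))^T *m v t).

Definition admissible (alpha : R) (q : R -> 'cV[R]_d) (p : R -> 'cV[R[i]]_d) :=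
  [/\ holderR I alpha q, holderC I alpha p,
      holderC I alpha (boxR I mu E q) & holderC I alpha (boxC I mu E p)].

Definition admissible_var (a b alpha beta : R)
    (u : R -> 'cV[R]_d) (v : R -> 'cV[R[i]]_d) :=
  [/\ holder0R I a b beta u, holder0C I a b beta v,
      holderC I alpha (boxR I mu E u) & holderC I alpha (boxC I mu E v)].

Definition selfadjoint_derivative (a b alpha beta : R) : Prop :=
  forall q p u v, admissible alpha q p -> admissible_var a b alpha beta u v ->
  forall t, I t -> Dqop q p u v t = Dqop_adj q p u v t.

End QuantumOperator.

Section ComplexTopology.
Variable R : realType.

Lemma cvg_mx (K : numFieldType) (T : Type) (F : set_system T) {FF : Filter F}
    m n (f : T -> 'M[K]_(m, n)) (M : 'M[K]_(m, n)) :
  (forall i j, f x i j @[x --> F] --> M i j) -> f x @[x --> F] --> M.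
Proof.
move=> h; apply/cvg_ballP => e e0.
have h2 : \forall x \near F, forall i j, ball (M i j) e (f x i j).
  apply: filter_forall => i; apply: filter_forall => j.
  by have /cvg_ballP := h i j; exact.
by apply: filterS h2 => x hx; split.
Qed.

Lemma normc_ge_ReIm (z : R[i]) (e : R) :
  `|z| < e%:C -> `|complex.Re z| < e /\ `|complex.Im z| < e.
Proof.
move=> ze; split; rewrite -ltcR; apply: le_lt_trans ze.
  exact: normc_ge_Re.
have := normc_ge_Re (z * 'i%C).
rewrite ReiNIm !normrN normrM.
have -> : `|'i%C : R[i]| = 1 by rewrite normc_def /= expr0n /= add0r expr1n sqrtr1.
by rewrite mulr1.
Qed.

Lemma Re_continuous : continuous (@complex.Re R : R[i] -> R).
Proof.
move=> z; apply/(@cvgrPdist_lt _ _ _ _ (nbhs_filter z)) => e e0.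
have e0' : 0 < e%:C by rewrite ltcR.
apply/nbhs_ballP; exists e%:C => // w /= /normc_ge_ReIm[+ _].
by rewrite raddfB.
Qed.

Lemma Im_continuous : continuous (@complex.Im R : R[i] -> R).
Proof.
move=> z; apply/(@cvgrPdist_lt _ _ _ _ (nbhs_filter z)) => e e0.
have e0' : 0 < e%:C by rewrite ltcR.
apply/nbhs_ballP; exists e%:C => // w /= /normc_ge_ReIm[_].
by rewrite raddfB.
Qed.

Lemma real_complex_continuous : continuous (real_complex R : R -> R[i]).
Proof.
move=> x; apply/cvgrPdist_lt => e e0.
have /andP[/eqP Ie Re0] : (complex.Im e == 0) && (0 < complex.Re e).
  by move: e0; rewrite ltcE.
apply/nbhs_ballP; exists (complex.Re e) => // y; rewrite /ball /=.
rewrite -rmorphB /= normc_def /= expr0n addr0 sqrtr_sqr => h.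
by rewrite ltcE /= Ie eqxx.
Qed.

Lemma mxRe_continuous m n : continuous (@mxRe R m n).
Proof.
move=> M; apply: (@cvg_mx _ _ _ (nbhs_filter M)) => i j; rewrite mxE; under eq_fun do rewrite mxE.
apply: (cvg_comp (fun M : 'M[R[i]]_(m, n) => M i j) (@complex.Re R)).
  exact: coord_continuous.
exact: Re_continuous.
Qed.

Lemma mxIm_continuous m n : continuous (@mxIm R m n).
Proof.
move=> M; apply: (@cvg_mx _ _ _ (nbhs_filter M)) => i j; rewrite mxE; under eq_fun do rewrite mxE.
apply: (cvg_comp (fun M : 'M[R[i]]_(m, n) => M i j) (@complex.Im R)).
  exact: coord_continuous.
exact: Im_continuous.
Qed.

Lemma cplx_continuous m n : continuous (@cplx R m n).
Proof.
move=> M; apply: (@cvg_mx _ _ _ (nbhs_filter M)) => i j; rewrite mxE; under eq_fun do rewrite mxE.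
apply: (cvg_comp (fun M : 'M[R]_(m, n) => M i j) (real_complex R)).
  exact: coord_continuous.
exact: real_complex_continuous.
Qed.

End ComplexTopology.

Section Step.
Variable R : realType.
Variable I : set R.

Let S t := [set r : R | 0 <= r <= 2 /\ forall s, `|s - t| < r -> I s].

Let S0 t : S t 0.
Proof. by split; [lra|move=> s /lt_geF; rewrite normr_ge0]. Qed.

Let Ssup t : has_sup (S t).
Proof. by split; [exists 0; exact: S0|exists 2 => r [/andP[]]]. Qed.

Lemma room_gt0 t : open I -> I t -> 0 < room I t.
Proof.
move=> oI It; have : nbhs t I by exact: open_nbhs_nbhs.
move=> /nbhs_ballP[e /= e0 he]; apply: divr_gt0 => //.
apply: (@lt_le_trans _ _ (Num.min e 2)); first by rewrite lt_min e0/=; lra.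
apply: ub_le_sup; first by case: (Ssup t).
split; first by rewrite le_min ge_min lexx orbT (ltW e0); lra.
by move=> s hs; apply: he; rewrite /ball /= distrC (lt_le_trans hs) // ge_min lexx.
Qed.

Lemma room_in t s : open I -> I t -> `|s - t| <= room I t -> I s.
Proof.
move=> oI It h; have r0 := room_gt0 oI It.
have /sup_adherent -/(_ _ (Ssup t))[r [_ hr] rlt] := r0.
by apply: hr; apply: le_lt_trans h _; move: rlt; rewrite /room -/(S t); lra.
Qed.

Lemma step_near t : open I -> I t -> \forall e \near 0^'+, step I t e = e.
Proof.
move=> oI It; near=> e; apply/min_idPl.
by near: e; apply: nbhs_right_le; exact: room_gt0.
Unshelve. all: by end_near. Qed.

Lemma room_lip t s : room I t <= room I s + `|t - s|.
Proof.
suff : sup (S t) <= sup (S s) + `|t - s|.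
  by rewrite /room -/(S t) -/(S s); have := normr_ge0 (t - s); lra.
have [] := Ssup t => nS _; apply: ge_sup nS _ => r [/andP[r0 r2] hr].
have [h|h] := leP r `|t - s|.
  rewrite (le_trans h) // lerDr.
  by apply: ub_le_sup; [case: (Ssup s)|exact: S0].
rewrite -lerBlDr; apply: ub_le_sup; first by case: (Ssup s).
split; first by have := normr_ge0 (t - s); move: h; lra.
move=> x hx; apply: hr; have := ler_distD s x t; rewrite [`|s - t|]distrC; lra.
Qed.

Lemma room_continuous : continuous (room I).
Proof.
move=> t; apply/cvgrPdist_le => e e0.
apply/nbhs_ballP; exists e => // s; rewrite /ball /=; have := room_lip t s; have := room_lip s t.
rewrite (distrC s t) ler_norml; lra.
Qed.

Lemma step_continuous : continuous (fun z : R * R => step I z.1 z.2).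
Proof.
move=> z; apply: (@continuous_min _ _ (fun z : R * R => z.2) (fun z => room I z.1)).
  exact: cvg_snd.
apply: (cvg_comp (fun z : R * R => z.1)); first exact: cvg_fst.
exact: room_continuous.
Qed.

End Step.

Section CplxLinear.
Variables (R : realType) (m n : nat).
Implicit Types (A B : 'M[R[i]]_(m, n)) (M N : 'M[R]_(m, n)).

Lemma cplxD M N : cplx (M + N) = cplx M + cplx N.
Proof. exact: map_mxD. Qed.
Lemma cplxB M N : cplx (M - N) = cplx M - cplx N.
Proof. exact: map_mxB. Qed.
Lemma cplxZ (c : R) M : cplx (c *: M) = c%:C *: cplx M.
Proof. exact: map_mxZ. Qed.
Lemma mxRe_lin (c : R) A B : mxRe (c%:C *: A + B) = c *: mxRe A + mxRe B.
Proof.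
by apply/matrixP => i j; rewrite !mxE; case: (A i j) (B i j) => [? ?] [? ?] /=; rewrite mul0r subr0.
Qed.
Lemma mxIm_lin (c : R) A B : mxIm (c%:C *: A + B) = c *: mxIm A + mxIm B.
Proof.
by apply/matrixP => i j; rewrite !mxE; case: (A i j) (B i j) => [? ?] [? ?] /=; rewrite mul0r addr0.
Qed.
Lemma mxReImE A : A = cplx (mxRe A) + 'i%C *: cplx (mxIm A).
Proof. by apply/matrixP => i j; rewrite !mxE -complexE. Qed.

Lemma cvg_cplx (T : Type) (F : set_system T) {FF : Filter F}
    (f : T -> 'M[R]_(m, n)) M :
  f x @[x --> F] --> M -> cplx (f x) @[x --> F] --> cplx M.
Proof. by move=> h; apply: (cvg_comp f (@cplx R m n) h); exact: cplx_continuous. Qed.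

End CplxLinear.

Section Mean.
Variables (R : realType) (d : nat) (I : set R) (mu : R[i]).
Hypothesis oI : open I.

Lemma slab_step z : slab I z ->
  [/\ I z.1, 0 < step I z.1 z.2, I (z.1 + step I z.1 z.2)
    & I (z.1 - step I z.1 z.2)].
Proof.
move=> [/= It]; rewrite in_itv /= => /andP[e0 e1].
have s0 : 0 < step I z.1 z.2 by rewrite lt_min e0 room_gt0.
have sr : `|step I z.1 z.2| <= room I z.1 by rewrite gtr0_norm // ge_min lexx orbT.
split=> //; apply: (room_in oI It).
  by rewrite addrAC subrr add0r.
by rewrite addrAC subrr add0r normrN.
Qed.

Lemma box_epsR_cont (f : R -> 'cV[R]_d) : {within I, continuous f} ->
  {within slab I, continuous (fun z => box_epsR mu f (step I z.1 z.2) z.1)}.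
Proof.
rewrite continuous_open_subspace // => fI.
apply: continuous_in_subspaceT => z; rewrite inE => /slab_step[It s0 Ip Im].
set s := fun z : R * R => step I z.1 z.2.
have cs : s x @[x --> z] --> s z by exact: step_continuous.
have c1 : x.1 @[x --> z] --> z.1 by exact: cvg_fst.
have cf (k : R * R -> R) : k x @[x --> z] --> k z -> I (k z) ->
    f (k x) @[x --> z] --> f (k z).
  by move=> kz Ik; apply: (cvg_comp k f kz); apply: fI; rewrite inE.
have cV : (s x)^-1 @[x --> z] --> (s z)^-1 by apply: cvgV => //; rewrite gt_eqF.
have cp : dplus f (s x) x.1 @[x --> z] --> dplus f (s z) z.1.
  apply: cvgZ => //; apply: cvgB; last exact: cf.
  by apply: (cf (fun x => x.1 + s x)) => //; exact: cvgD.
have cm : dminus f (s x) x.1 @[x --> z] --> dminus f (s z) z.1.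
  apply: cvgZ => //; apply: cvgB; first exact: cf.
  by apply: (cf (fun x => x.1 - s x)) => //; exact: cvgB.
apply: cvgZl_tmp; apply: cvgD; last apply: cvgZl_tmp; apply: cvg_cplx.
  exact: cvgD cp cm.
exact: cvgB cp cm.
Qed.

Lemma box_epsC_cont (f : R -> 'cV[R[i]]_d) : {within I, continuous f} ->
  {within slab I, continuous (fun z => box_epsC mu f (step I z.1 z.2) z.1)}.
Proof.
move=> fI z.
have fRe : {within I, continuous (mxRe \o f)}.
  by move=> x; apply: (cvg_comp _ (@mxRe R d 1) (fI x)); exact: mxRe_continuous.
have fIm : {within I, continuous (mxIm \o f)}.
  by move=> x; apply: (cvg_comp _ (@mxIm R d 1) (fI x)); exact: mxIm_continuous.
apply: (@cvgD _ _ _ _ (nbhs_filter z)); first exact: box_epsR_cont.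
by apply: (@cvgZl_tmp _ _ _ _ (nbhs_filter z)); exact: box_epsR_cont.
Qed.

Lemma C0_ReIm (g : R * R -> 'cV[R[i]]_d) : {within slab I, continuous g} ->
  C0 I (mxRe \o g) /\ C0 I (mxIm \o g).
Proof.
move=> cg; split=> z.
  by apply: (cvg_comp _ (@mxRe R d 1) (cg z)); exact: mxRe_continuous.
by apply: (cvg_comp _ (@mxIm R d 1) (cg z)); exact: mxIm_continuous.
Qed.

Variable E : set (R * R -> 'cV[R]_d).
Hypothesis hE : complementary I E.

Lemma near_slab t : I t -> \forall e \near 0^'+, slab I (t, e).
Proof.
move=> It; near=> e; split => //=; rewrite in_itv /=; apply/andP; split.
  by near: e; exact: nbhs_right_gt.
by near: e; exact: nbhs_right_le.
Unshelve. all: by end_near. Qed.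

Lemma C0_lin (c : R) (g h : R * R -> 'cV[R]_d) : C0 I g -> C0 I h ->
  C0 I (fun z => c *: g z + h z).
Proof.
move=> Cg Ch z; apply: (@cvgD _ _ _ _ (nbhs_filter z)); last exact: Ch.
by apply: (@cvgZl_tmp _ _ _ _ (nbhs_filter z)); exact: Cg.
Qed.

Lemma C0conv_lin (c : R) (g h : R * R -> 'cV[R]_d) : C0conv I g -> C0conv I h ->
  C0conv I (fun z => c *: g z + h z).
Proof.
move=> [Cg lg] [Ch lh]; split; first exact: C0_lin.
by move=> t It; apply: is_cvgD; [apply: is_cvgZl_tmp; exact: lg|exact: lh].
Qed.

Lemma cvg_near_slab (g h : R * R -> 'cV[R]_d) t : I t ->
  (forall z, slab I z -> h z = g z) ->
  cvg (g (t, e) @[e --> 0^'+]) -> cvg (h (t, e) @[e --> 0^'+]).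
Proof.
move=> It hg /cvg_ex[l gl]; apply/cvg_ex; exists l; apply: cvg_trans gl.
apply: near_eq_cvg; apply: filterS (near_slab It) => e se.
by rewrite hg.
Qed.

Lemma projP (g : R * R -> 'cV[R]_d) : C0 I g -> C0conv I (conv_part I E g) /\
  exists2 gE, E gE & forall z, slab I z -> g z = conv_part I E g z + gE z.
Proof.
move=> Cg; case: hE => _ _ /(_ _ Cg)[gc [gE [? ? ?]]] _.
rewrite /conv_part; case: (getPex (P := [set gc | C0conv I gc /\
   exists2 gE, E gE & forall z, slab I z -> g z = gc z + gE z])) => //.
by exists gc; split=> //; exists gE.
Qed.

Lemma proj_uniq (g gc gE : R * R -> 'cV[R]_d) : C0conv I gc -> E gE ->
  (forall z, slab I z -> g z = gc z + gE z) ->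
  forall z, slab I z -> conv_part I E g z = gc z.
Proof.
move=> Cgc EgE geq.
case: (hE) => EC [E0 Elin] _ Euniq.
have Cg : C0 I g.
  have C1 := C0_lin (c := 1) Cgc.1 (EC _ EgE).
  have e1 : {in slab I, (fun z => 1 *: gc z + gE z) =1 g}.
    by move=> x /set_mem sx; rewrite scale1r geq.
  exact: (subspace_eq_continuous e1 C1).
have [Cp [pE EpE peq]] := projP Cg.
have Eh := Elin (-1) _ _ EpE EgE.
have hh x : slab I x -> -1 *: pE x + gE x = -1 *: gc x + conv_part I E g x.
  move=> sx; have := peq x sx; rewrite geq // => h.
  apply/matrixP => i j; have := congr1 (fun M : 'cV[R]_d => M i j) h.
  by rewrite !mxE; lra.
have Ch := C0conv_lin (-1) Cgc Cp.
have Ch' : C0conv I (fun z => -1 *: pE z + gE z).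
  split; first exact: EC.
  move=> t It; apply: (@cvg_near_slab (fun z => -1 *: gc z + conv_part I E g z)
    (fun z => -1 *: pE z + gE z) t It).
    by move=> z /hh.
  exact: Ch.2.
move=> z sz; have := hh z sz; rewrite (Euniq _ Ch' Eh z sz) => h0.
apply/matrixP => i j; have := congr1 (fun M : 'cV[R]_d => M i j) h0.
by rewrite !mxE; lra.
Qed.

Lemma conv_part_id (g : R * R -> 'cV[R]_d) : C0conv I g -> forall z, slab I z -> conv_part I E g z = g z.
Proof.
case: (hE) => _ [E0 _] _ _ Cg; apply: (proj_uniq Cg E0) => z _.
by rewrite addr0.
Qed.

Lemma conv_part_lin c (g h : R * R -> 'cV[R]_d) : C0 I g -> C0 I h -> forall z, slab I z ->
  conv_part I E (fun z => c *: g z + h z) z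
  = c *: conv_part I E g z + conv_part I E h z.
Proof.
case: (hE) => _ [_ Elin] _ _ /projP[Cg [gE EgE geq]] /projP[Ch [hE' EhE heq]].
apply: (proj_uniq (C0conv_lin (c) Cg Ch) (Elin c _ _ EgE EhE)) => z sz.
by rewrite geq // heq // scalerDr addrACA.
Qed.

Lemma conv_partC_cvg (g : R * R -> 'cV[R[i]]_d) t : {within slab I, continuous g} -> I t ->
  cvg (conv_partC I E g (t, e) @[e --> 0^'+]).
Proof.
move=> /C0_ReIm[/projP[[_ /(_ _) c1] _] /projP[[_ /(_ _) c2] _]] It.
apply: is_cvgD; last apply: is_cvgZl_tmp; apply: cvgP; apply: cvg_cplx.
  exact: c1.
exact: c2.
Qed.

Lemma mean_lin (c : R) (g h : R * R -> 'cV[R[i]]_d) t :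
  {within slab I, continuous g} -> {within slab I, continuous h} -> I t ->
  mean I E (fun z => c%:C *: g z + h z) t = c%:C *: mean I E g t + mean I E h t.
Proof.
move=> Cg Ch It; have [gR gI] := C0_ReIm Cg; have [hR hI] := C0_ReIm Ch.
apply: cvg_lim => //.
have : c%:C *: conv_partC I E g (t, e) + conv_partC I E h (t, e) @[e --> 0^'+]
    --> c%:C *: mean I E g t + mean I E h t.
  by apply: cvgD; [apply: cvgZl_tmp|]; exact: conv_partC_cvg.
apply: cvg_trans; apply: near_eq_cvg; apply: filterS (near_slab It) => e se.
rewrite /conv_partC.
have -> : mxRe \o (fun z => c%:C *: g z + h z)
          = (fun z => c *: (mxRe \o g) z + (mxRe \o h) z).
  by apply/funext => z; rewrite /= mxRe_lin.
have -> : mxIm \o (fun z => c%:C *: g z + h z)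
          = (fun z => c *: (mxIm \o g) z + (mxIm \o h) z).
  by apply/funext => z; rewrite /= mxIm_lin.
rewrite !conv_part_lin // !cplxD !cplxZ !scalerDr addrACA; congr (_ + _ + _).
by rewrite !scalerA mulrC.
Qed.

Lemma mean_germ (g h : R * R -> 'cV[R[i]]_d) :
  {within slab I, continuous g} -> {within slab I, continuous h} ->
  (forall t, I t -> \forall e \near 0^'+, g (t, e) = h (t, e)) ->
  forall t, I t -> mean I E g t = mean I E h t.
Proof.
move=> Cg Ch gh t It.
pose D z := (-1)%:C *: g z + h z.
have D0 s : I s -> \forall e \near 0^'+, D (s, e) = 0.
  move=> /gh; apply: filterS => e; rewrite /D => ->.
  by rewrite rmorphN1 scaleN1r addNr.
have CD : {within slab I, continuous D}.
  move=> z; apply: (@cvgD _ _ _ _ (nbhs_filter z)); last exact: Ch.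
  by apply: (@cvgZl_tmp _ _ _ _ (nbhs_filter z)); exact: Cg.
have [DR DI] := C0_ReIm CD.
have DRc : C0conv I (mxRe \o D).
  split=> // s Is; apply/cvg_ex; exists 0; apply: cvg_near_cst.
  by apply: filterS (D0 s Is) => e /= ->; rewrite /mxRe map_mx0.
have DIc : C0conv I (mxIm \o D).
  split=> // s Is; apply/cvg_ex; exists 0; apply: cvg_near_cst.
  by apply: filterS (D0 s Is) => e /= ->; rewrite /mxIm map_mx0.
have : mean I E D t = 0.
  apply: cvg_lim => //; apply: cvg_near_cst.
  apply: filterS2 (near_slab It) (D0 t It) => e se De.
  by rewrite /conv_partC !conv_part_id //= -mxReImE De.
have -> : mean I E D t = (-1)%:C *: mean I E g t + mean I E h t.
  exact: mean_lin.
have -> : (-1)%:C = -1 :> R[i] by rewrite rmorphN1.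
by rewrite scaleN1r addrC => /subr0_eq ->.
Qed.

Lemma lin_aux2 (K : fieldType) m n (c k : K) (P Q S T : 'M[K]_(m, n)) :
  c *: P + Q + k *: (c *: S + T) = c *: (P + k *: S) + (Q + k *: T).
Proof. by apply/matrixP => i j; rewrite !mxE; ring. Qed.

Lemma lin_aux1 (K : fieldType) m n (c k l : K) (P Q S T : 'M[K]_(m, n)) :
  l *: (c *: P + Q + k *: (c *: S + T))
  = c *: (l *: (P + k *: S)) + l *: (Q + k *: T).
Proof. by apply/matrixP => i j; rewrite !mxE; ring. Qed.

Lemma box_epsR_lin (c : R) (f g : R -> 'cV[R]_d) e t :
  box_epsR mu (fun s => c *: f s + g s) e t
  = c%:C *: box_epsR mu f e t + box_epsR mu g e t.
Proof.
have dp : dplus (fun s => c *: f s + g s) e t = c *: dplus f e t + dplus g e t.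
  by apply/matrixP => i j; rewrite !mxE; ring.
have dm : dminus (fun s => c *: f s + g s) e t = c *: dminus f e t + dminus g e t.
  by apply/matrixP => i j; rewrite !mxE; ring.
rewrite /box_epsR dp dm.
have -> : c *: dplus f e t + dplus g e t + (c *: dminus f e t + dminus g e t)
  = c *: (dplus f e t + dminus f e t) + (dplus g e t + dminus g e t).
  by apply/matrixP => i j; rewrite !mxE; ring.
have -> : c *: dplus f e t + dplus g e t - (c *: dminus f e t + dminus g e t)
  = c *: (dplus f e t - dminus f e t) + (dplus g e t - dminus g e t).
  by apply/matrixP => i j; rewrite !mxE; ring.
by rewrite !(cplxD (c *: _)) !cplxZ lin_aux1.
Qed.

Lemma box_epsC_lin (c : R) (f g : R -> 'cV[R[i]]_d) e t :
  box_epsC mu (fun s => c%:C *: f s + g s) e t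
  = c%:C *: box_epsC mu f e t + box_epsC mu g e t.
Proof.
rewrite /box_epsC.
have -> : mxRe \o (fun z => c%:C *: f z + g z)
          = (fun z => c *: (mxRe \o f) z + (mxRe \o g) z).
  by apply/funext => z; rewrite /= mxRe_lin.
have -> : mxIm \o (fun z => c%:C *: f z + g z)
          = (fun z => c *: (mxIm \o f) z + (mxIm \o g) z).
  by apply/funext => z; rewrite /= mxIm_lin.
by rewrite !box_epsR_lin lin_aux2.
Qed.

Lemma boxR_lin (c : R) (f g : R -> 'cV[R]_d) t :
  {within I, continuous f} -> {within I, continuous g} -> I t ->
  boxR I mu E (fun s => c *: f s + g s) t
  = c%:C *: boxR I mu E f t + boxR I mu E g t.
Proof.
move=> cf cg It.
apply: eq_trans (mean_lin c (box_epsR_cont cf) (box_epsR_cont cg) It).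
by congr (mean I E _ t); apply/funext => z; rewrite box_epsR_lin.
Qed.

Lemma boxC_lin (c : R) (f g : R -> 'cV[R[i]]_d) t :
  {within I, continuous f} -> {within I, continuous g} -> I t ->
  boxC I mu E (fun s => c%:C *: f s + g s) t
  = c%:C *: boxC I mu E f t + boxC I mu E g t.
Proof.
move=> cf cg It.
apply: eq_trans (mean_lin c (box_epsC_cont cf) (box_epsC_cont cg) It).
by congr (mean I E _ t); apply/funext => z; rewrite box_epsC_lin.
Qed.
End Mean.

Section ChainRule.
Variables (R : realType) (d : nat).

Lemma sum_delta (K : fieldType) (v : 'cV[K]_d) :
  v = \sum_j v j 0 *: delta_mx j 0.
Proof.
rewrite {1}[v]matrix_sum_delta; apply: eq_bigr => j _.
by rewrite big_ord1.
Qed.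

Lemma derive_sum (K : numFieldType) (f : 'cV[K]_d -> K) p v : differentiable f p ->
  'D_v f p = \sum_j v j 0 * 'D_(delta_mx j 0) f p.
Proof.
move=> df; rewrite deriveE // {1}(sum_delta v) linear_sum.
by apply: eq_bigr => j _; rewrite linearZ deriveE.
Qed.

Lemma derivable_line (K : numFieldType) (f : 'cV[K]_d -> K) q (u : 'cV[K]_d) (s : K) :
  differentiable f (s *: u + q) ->
  is_derive s 1 (fun x : K => f (x *: u + q)) ('D_u f (s *: u + q)).
Proof.
move=> df.
have e : (fun h : K => h^-1 *: (((fun x : K => f (x *: u + q)) \o shift s) (h *: 1)
              - f (s *: u + q)))
  = (fun h : K => h^-1 *: ((f \o shift (s *: u + q)) (h *: u) - f (s *: u + q))).
  apply/funext => h /=; congr (_ *: (f _ - _)).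
  by rewrite addrA -scalerDl /GRing.scale /= mulr1.
have dd : derivable f (s *: u + q) u := diff_derivable df.
by split; rewrite /derivable /derive e.
Qed.

Lemma line_real (G : 'cV[R]_d -> 'cV[R[i]]_d -> R) (q u : 'cV[R]_d) (p v : 'cV[R[i]]_d) :
  (forall q p, differentiable (G ^~ p) q) ->
  {for (q, p), continuous (fun z : 'cV[R]_d * 'cV[R[i]]_d => 'D_u (G ^~ z.2) z.1)} ->
  (x^-1 * (G (x *: u + q) (x%:C *: v + p) - G q (x%:C *: v + p)))
    @[x --> (0 : R)^'] --> 'D_u (G ^~ p) q.
Proof.
move=> dG cK.
have hex (x : R) : exists c : R, 0 <= c <= 1 /\
   G (x *: u + q) (x%:C *: v + p) - G q (x%:C *: v + p)
   = x * 'D_u (G ^~ (x%:C *: v + p)) ((x * c) *: u + q).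
  set p' := _ + p.
  have hd (s : R) : is_derive s (1 : R) (fun y : R => G (y *: (x *: u) + q) p')
      ('D_(x *: u) (G ^~ p') (s *: (x *: u) + q)).
    exact: (@derivable_line _ (G ^~ p') q (x *: u) s (dG _ _)).
  have hc : {within `[0, 1], continuous (fun y : R => G (y *: (x *: u) + q) p')}.
    by apply: derivable_within_continuous => s _; case: (hd s).
  have [s s01] := MVT_segment ler01 (fun s _ => hd s) hc.
  rewrite scale1r scale0r add0r subr0 mulr1 => ->.
  exists s; split; first by move: s01; rewrite in_itv.
  rewrite scalerA (mulrC s) deriveE // linearZ /= -deriveE //.
have [c hc] := choice hex.
have c0 : x * c x @[x --> (0 : R)^'] --> (0 : R).
  apply/cvgrPdist_le => e e0; near=> x.
  rewrite sub0r normrN normrM (le_trans (ler_wpM2l (normr_ge0 x) (_ : `|c x| <= 1))) //.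
    by have [/andP[c0 c1] _] := hc x; rewrite ger0_norm.
  by rewrite mulr1; near: x; exact: dnbhs0_le.
have rc0 : x%:C @[x --> (0 : R)^'] --> (0 : R[i]).
  apply: cvg_trans (@real_complex_continuous R 0).
  by apply: cvg_app; exact: nbhs_dnbhs.
have c1 : (x * c x) *: u + q @[x --> (0 : R)^'] --> q.
  rewrite -[X in _ --> X](add0r q) -(scale0r u).
  by apply: cvgD; [exact: cvgZr_tmp|exact: cvg_cst].
have c2 : x%:C *: v + p @[x --> (0 : R)^'] --> p.
  rewrite -[X in _ --> X](add0r p) -(scale0r v).
  by apply: cvgD; [exact: cvgZr_tmp|exact: cvg_cst].
have cv : ((x * c x) *: u + q, x%:C *: v + p) @[x --> (0 : R)^'] --> (q, p).
  exact: (@cvg_pair _ _ _ _ (nbhs q) (nbhs p) _ (nbhs_filter q) (nbhs_filter p)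
    _ _ c1 c2).
have := cvg_comp _ _ cv cK.
apply: cvg_trans; apply: near_eq_cvg; near=> x.
rewrite /= (hc x).2 mulKf //; near: x; exact: nbhs_dnbhs_neq.
Unshelve. all: by end_near. Qed.

Lemma line_complex (F : 'cV[R[i]]_d -> R[i]) (p v : 'cV[R[i]]_d) : differentiable F p ->
  ((x^-1)%:C * (F (x%:C *: v + p) - F p)) @[x --> (0 : R)^'] --> 'D_v F p.
Proof.
move=> dF; have dd : derivable F p v := diff_derivable dF.
have h0 : x%:C @[x --> (0 : R)^'] --> (0 : R[i])^'.
  move=> A /= [e /= e0 he].
  have /andP[/eqP Ie Re0] : (complex.Im e == 0) && (0 < complex.Re e).
    by move: e0; rewrite ltcE.
  exists (complex.Re e) => // x /=; rewrite sub0r normrN => xe x0.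
  apply: he => /=; last by rewrite -(rmorph0 (real_complex R)) (inj_eq (@complexI R)).
  by rewrite sub0r normrN normc_def /= expr0n addr0 sqrtr_sqr ltcE /= Ie eqxx.
have := cvg_comp _ _ h0 dd.
apply: cvg_trans; apply: near_eq_cvg; apply: nearW => x /=.
by rewrite fmorphV.
Qed.

Lemma cvg_complex (T : Type) (F : set_system T) {FF : Filter F} (f : T -> R[i]) l :
  complex.Re (f x) @[x --> F] --> complex.Re l ->
  complex.Im (f x) @[x --> F] --> complex.Im l ->
  f x @[x --> F] --> l.
Proof.
move=> hR hI; rewrite [l]complexE.
under eq_fun do rewrite [f _]complexE.
apply: cvgD; last apply: cvgZl_tmp.
  by apply: (cvg_comp _ (real_complex R) hR); exact: real_complex_continuous.
by apply: (cvg_comp _ (real_complex R) hI); exact: real_complex_continuous.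
Qed.

Variable X : 'cV[R]_d -> 'cV[R[i]]_d -> 'cV[R[i]]_d.

Lemma derive_field (q u : 'cV[R]_d) (p v : 'cV[R[i]]_d) : C1_field X ->
  (x^-1)%:C *: (X (x *: u + q) (x%:C *: v + p) - X q p) @[x --> (0 : R)^']
    --> jac_q X q p *m cplx u + jac_p X q p *m v.
Proof.
move=> [dX _ cq cp]; apply: cvg_mx => i j; rewrite ord1 {j}.
have [dq dp] := dX i.
have e1 : (jac_q X q p *m cplx u + jac_p X q p *m v) i 0
  = (('D_u (fun q' => complex.Re (X q' p i 0)) q)
     +i* ('D_u (fun q' => complex.Im (X q' p i 0)) q)) + 'D_v (component X i q) p.
  rewrite mxE; congr (_ + _); rewrite mxE; last first.
    rewrite derive_sum //; apply: eq_bigr => j _.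
    by rewrite mxE mulrC.
  rewrite !derive_sum; [|exact: (dq q p).2|exact: (dq q p).1].
  rewrite [RHS]complexE /= !rmorph_sum /= mulr_sumr -big_split /=.
  apply: eq_bigr => j _; rewrite !mxE /partial_q [_ +i* _]complexE /= !rmorphM /=.
  rewrite mulrDl; congr (_ + _); first by rewrite mulrC.
  by rewrite -mulrA; congr (_ * _); rewrite mulrC.
have hd (pr : R[i] -> R) : (pr = @complex.Re R \/ pr = @complex.Im R) ->
    (forall q p, differentiable (fun q' => pr (X q' p i 0)) q) ->
    (forall q p j, pr (jac_q X q p i j)
       = 'D_(delta_mx j 0) (fun q' => pr (X q' p i 0)) q) ->
  (x^-1 * (pr (X (x *: u + q) (x%:C *: v + p) i 0) - pr (X q (x%:C *: v + p) i 0)))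
    @[x --> (0 : R)^'] --> 'D_u (fun q' => pr (X q' p i 0)) q.
  move=> prE dpr jpr.
  apply: (@line_real (fun q p => pr (X q p i 0))) => //.
  have -> : (fun z : 'cV[R]_d * 'cV[R[i]]_d => 'D_u (fun q' => pr (X q' z.2 i 0)) z.1)
     = (fun z => \sum_j u j 0 * pr (jac_q X z.1 z.2 i j)).
    apply/funext => z; rewrite derive_sum; last exact: dpr.
    by apply: eq_bigr => j _; rewrite jpr.
  apply: (@cvg_big _ _ +%R 0 _ add_continuous) => j _; apply: cvgMl_tmp.
  have cpr : continuous pr by case: prE => ->; [exact: Re_continuous|exact: Im_continuous].
  apply: (cvg_comp (fun z => jac_q X z.1 z.2 i j) pr); last exact: cpr.
  apply: (cvg_comp (fun z => jac_q X z.1 z.2) (fun M => M i j) (cq _)).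
  exact: coord_continuous.
rewrite e1.
have -> : (fun x : R => ((x^-1)%:C *: (X (x *: u + q) (x%:C *: v + p) - X q p)) i 0)
  = (fun x : R => (x^-1)%:C * (X (x *: u + q) (x%:C *: v + p) i 0
                               - X q (x%:C *: v + p) i 0)
        + (x^-1)%:C * (component X i q (x%:C *: v + p) - component X i q p)).
  by apply/funext => x; rewrite !mxE -mulrDr addrA subrK.
apply: cvgD; last exact: line_complex.
have reM (x : R) (w : R[i]) : complex.Re (x%:C * w) = x * complex.Re w.
  by case: w => ? ?; rewrite /= mul0r subr0.
have imM (x : R) (w : R[i]) : complex.Im (x%:C * w) = x * complex.Im w.
  by case: w => ? ?; rewrite /= mul0r addr0.
apply: cvg_complex => /=.
  under eq_fun do rewrite reM raddfB.
  apply: hd; first by left.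
    by move=> q' p'; exact: (dq q' p').1.
  by move=> q' p' j; rewrite mxE.
under eq_fun do rewrite imM raddfB.
apply: hd; first by right.
  by move=> q' p'; exact: (dq q' p').2.
by move=> q' p' j; rewrite mxE.
Qed.
End ChainRule.

Section Derive.
Variables (R : realType) (d : nat) (I : set R) (mu : R[i]).
Variables (E : set (R * R -> 'cV[R]_d)).
Variables (Xq Xp : 'cV[R]_d -> 'cV[R[i]]_d -> 'cV[R[i]]_d).

Lemma Dqop_derive (q u : R -> 'cV[R]_d) (p v : R -> 'cV[R[i]]_d) (t : R) :
  open I -> complementary I E -> C1_field Xq -> C1_field Xp ->
  {within I, continuous q} -> {within I, continuous u} ->
  {within I, continuous p} -> {within I, continuous v} -> I t ->
  (x^-1)%:C *: (qop I mu E Xq Xp (fun s => x *: u s + q s)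
                  (fun s => x%:C *: v s + p s) t - qop I mu E Xq Xp q p t)
    @[x --> (0 : R)^'] --> Dqop I mu E Xq Xp q p u v t.
Proof.
move=> oI hE CXq CXp cq cu cp cv It.
have cvg_col (f g : R -> 'cV[R[i]]_d) (a b : 'cV[R[i]]_d) : f x @[x --> (0 : R)^'] --> a ->
   g x @[x --> (0 : R)^'] --> b -> col_mx (f x) (g x) @[x --> (0 : R)^'] --> col_mx a b.
  move=> fa gb.
  apply: (@cvg_mx R[i] R (0 : R)^' _ (d + d)%N 1 (fun x => col_mx (f x) (g x))) => i j.
  under eq_fun do rewrite mxE.
  rewrite mxE; case: (fintype.split i) => k.
    by apply: (cvg_comp _ (fun M : 'cV[R[i]]_d => M k j) fa); exact: coord_continuous.
  by apply: (cvg_comp _ (fun M : 'cV[R[i]]_d => M k j) gb); exact: coord_continuous.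
rewrite /Dqop -!addrA -!opprD.
have hx : \forall x \near (0 : R)^', col_mx
    (boxR I mu E u t - (x^-1)%:C *: (Xq (x *: u t + q t) (x%:C *: v t + p t) - Xq (q t) (p t)))
    (boxC I mu E v t - (x^-1)%:C *: (Xp (x *: u t + q t) (x%:C *: v t + p t) - Xp (q t) (p t)))
  = (x^-1)%:C *: (qop I mu E Xq Xp (fun s => x *: u s + q s)
                  (fun s => x%:C *: v s + p s) t - qop I mu E Xq Xp q p t).
  near=> x.
  have x0 : x != 0 by near: x; exact: nbhs_dnbhs_neq.
  rewrite /qop boxR_lin // boxC_lin // opp_col_mx add_col_mx scale_col_mx.
  have al (K : fieldType) m (c : K) (b b' X X' : 'cV[K]_m) : c != 0 ->
     b - c^-1 *: (X' - X) = c^-1 *: (c *: b + b' - X' - (b' - X)).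
    move=> c0; apply/matrixP => i j; rewrite !mxE; field; exact: c0.
  have xC0 : x%:C != 0 by rewrite -(rmorph0 (real_complex R)) (inj_eq (@complexI R)).
  by rewrite fmorphV; congr col_mx; exact: al.
apply: cvg_trans; first exact: (near_eq_cvg hx).
apply: cvg_col; apply: cvgB; try exact: cvg_cst; exact: derive_field.
Unshelve. all: by end_near. Qed.
End Derive.

(* Main.v *)
Require Import Defs.
From HB Require Import structures.
From mathcomp Require Import all_boot all_order all_algebra.
From mathcomp Require Import all_classical all_reals all_analysis.
From mathcomp Require Import complex ring lra.
Import Order.TTheory GRing.Theory Num.Theory.
Import numFieldNormedType.Exports.
Set Implicit Arguments.
Unset Strict Implicit.
Local Open Scope classical_set_scope.
Local Open Scope ring_scope.
Local Open Scope complex_scope.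

(* Both properties amount to the closedness of the 1-form [omega = Xq . dp - Xp . dq].
   If [H] is a Hamiltonian then [omega = dH], and closedness is the symmetry of
   second derivatives, applied on the planes spanned by two directions, each along
   [q] or along [p].  Conversely, if [omega] is closed, then differentiating
   [explicit_H], which is the integral of [omega] along the segment from 0 to (q, p),
   under the integral sign shows that its derivative along every line is [omega]
   (Poincare lemma); as [omega] is continuous, this derivative is a Frechet one.

   In coordinates closedness says that d Xq/dp and d Xp/dq are symmetric and that
   d Xq/dq = - (d Xp/dp)^T, which is the equality of [Dqop] and [Dqop_adj] up to
   testing on enough variations.  Constant (q, p) and variations
   (t - a) (b - t) w suffice: the quantum derivative of a differentiable function
   is its classical derivative, so these are admissible. *)

(** * Mean values, mixed second derivatives and integrals depending on a parameter *)

Section RealAnalysis.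
Variable R : realType.

Lemma MVT_quotient (f f' : R -> R) (h : R) : 0 <= h ->
  (forall s, is_derive s (1 : R) f (f' s)) ->
  exists2 c, 0 <= c <= h & f h - f 0 = h * f' c.
Proof.
move=> h0 df.
have cf : {within `[0, h], continuous f}.
  by apply: derivable_within_continuous => s _; case: (df s).
have [c ch ->] := MVT_segment h0 (fun s _ => df s) cf.
by exists c; [move: ch; rewrite in_itv | rewrite subr0 mulrC].
Qed.

(** Schwarz's theorem. The second difference of [g] over the square of side [h] at the origin is
    evaluated by two mean value theorems in either order, giving [h ^ 2] times a value of [g12] or
    of [g21]; continuity at the origin concludes as [h] tends to 0. *)
Lemma mixed_derivatives_eq (g g1 g2 g12 g21 : R -> R -> R) :
  (forall s t, is_derive s (1 : R) (g ^~ t) (g1 s t)) ->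
  (forall s t, is_derive t (1 : R) (g s) (g2 s t)) ->
  (forall s t, is_derive t (1 : R) (g1 s) (g12 s t)) ->
  (forall s t, is_derive s (1 : R) (g2 ^~ t) (g21 s t)) ->
  {for (0, 0), continuous (fun z => g12 z.1 z.2)} ->
  {for (0, 0), continuous (fun z => g21 z.1 z.2)} ->
  g12 0 0 = g21 0 0.
Proof.
move=> d1 d2 d12 d21 c12 c21.
apply/eqP; rewrite -subr_eq0 -normr_le0; apply/ler_addgt0Pr => e e0; rewrite add0r.
have e20 : 0 < e / 2 by rewrite divr_gt0.
have n12 := (@cvgrPdist_lt _ _ _ _ (nbhs_filter (0, 0)) _ _).1 c12 _ e20.
have n21 := (@cvgrPdist_lt _ _ _ _ (nbhs_filter (0, 0)) _ _).1 c21 _ e20.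
have [r /= r0 h12] := (nbhs_ballP _ _).1 n12.
have [r' /= r'0 h21] := (nbhs_ballP _ _).1 n21.
(* Half the smaller radius: the mean value points may equal [h] and must still lie in the open
   balls. *)
pose h := Num.min r r' / 2.
have h0 : 0 < h by rewrite divr_gt0 // lt_min r0 r'0.
have [hr hr'] : h < r /\ h < r'.
  suff : h < Num.min r r' by rewrite lt_min => /andP[].
  by rewrite ltr_pdivrMr // ltr_pMr ?ltr1n // lt_min r0.
have dB (f f' k k' : R -> R) : (forall s, is_derive s (1 : R) f (f' s)) ->
   (forall s, is_derive s (1 : R) k (k' s)) ->
   forall s, is_derive s (1 : R) (fun s => f s - k s) (f' s - k' s).
  by move=> df dk s; apply: is_deriveB.
have [c /andP[c0 ch] e1] := MVT_quotient (ltW h0) (dB _ _ _ _ (d1 ^~ h) (d1 ^~ 0)).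
have [c' /andP[c'0 c'h] e2] := MVT_quotient (ltW h0) (d12 c).
have [k /andP[k0 kh] e3] := MVT_quotient (ltW h0) (dB _ _ _ _ (d2 h) (d2 0)).
have [k' /andP[k'0 k'h] e4] := MVT_quotient (ltW h0) (d21 ^~ k).
(* Multiplied by [h ^ 2], both sides are the second difference [g h h - g h 0 - g 0 h + g 0 0]. *)
have E : g12 c c' = g21 k' k.
  have hn0 : h != 0 by rewrite gt_eqF.
  apply: (mulfI hn0); apply: (mulfI hn0).
  by rewrite -e2 -e4 -e1 -e3; ring.
have lt1 : `|g12 0 0 - g12 c c'| < e / 2.
  apply: (h12 (c, c')); split; rewrite /ball /= sub0r normrN ger0_norm //; lra.
have lt2 : `|g21 0 0 - g21 k' k| < e / 2.
  apply: (h21 (k', k)); split; rewrite /ball /= sub0r normrN ger0_norm //; lra.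
apply: le_trans (ler_distD (g12 c c') _ _) _.
by rewrite (splitr e) lerD ?(ltW lt1) // E distrC (ltW lt2).
Qed.

Lemma continuous_slice (f : R -> R -> R) (x : R) :
  continuous (fun z : R * R => f z.1 z.2) -> continuous (f x).
Proof.
move=> cf y; apply: (cvg_comp (fun y => (x, y)) _ _ (cf (x, y))).
exact: (cvg_pair (cvg_cst x) cvg_id).
Qed.

(** Dominated convergence: the continuous [g] is bounded on the compact rectangle [[x - 1, x + 1] *
    [0, 1]], and constants are integrable over [[0, 1]]. *)
Lemma is_derive_Rintegral01 (f g : R -> R -> R) (x : R) :
  (forall x y, is_derive x (1 : R) (f ^~ y) (g x y)) ->
  continuous (fun z : R * R => f z.1 z.2) ->
  continuous (fun z : R * R => g z.1 z.2) ->
  is_derive x (1 : R) (fun x => \int[lebesgue_measure]_(y in `[0%R, 1%R]) f x y)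
    (\int[lebesgue_measure]_(y in `[0%R, 1%R]) g x y).
Proof.
move=> df cf cg.
have gE x' y : partial1of2 f x' y = g x' y.
  by rewrite partial1of2E; case: (df x' y).
have intc (h : R -> R) : continuous h ->
    lebesgue_measure.-integrable (`[0%R, 1%R] : set R) (EFin \o h).
  move=> ch; apply: continuous_compact_integrable; first exact: segment_compact.
  exact: continuous_subspaceT.
have [M [_ hM]] : bounded_set ((fun z : R * R => g z.1 z.2) @` (`[x - 1, x + 1] `*` `[0, 1])).
  apply: compact_bounded; apply: continuous_compact.
    exact: continuous_subspaceT.
  by apply: compact_setX; exact: segment_compact.
have ax : `](x - 1), (x + 1)[%classic x by rewrite /= in_itv /=; lra.
(* Every real above [M] bounds [g], hence [M + 1]; the absolute value makes the dominating function
   visibly nonnegative. *)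
pose G : R -> R := cst `|M + 1|.
have H := @cvg_differentiation_under_integral R _ _ lebesgue_measure f `[0%R, 1%R]
  (measurable_itv _) x (x - 1) (x + 1) ax (fun x' _ => intc _ (continuous_slice cf))
  (fun x' y _ _ => @ex_derive _ _ _ _ _ _ _ (df x' y))
  G (fun _ => normr_ge0 _) (intc G (@cst_continuous _ _ _)).
have {}H := H _.
set F := fun x => _.
have {}H : h^-1 *: (F (h *: 1 + x) - F x) @[h --> 0^'] -->
    \int[lebesgue_measure]_(y in `[0%R, 1%R]) g x y.
  under eq_fun do rewrite scaler1.
  have -> : \int[lebesgue_measure]_(y in `[0%R, 1%R]) g x y
      = \int[lebesgue_measure]_(y in `[0%R, 1%R]) partial1of2 f x y.
    by apply: eq_Rintegral => y _; rewrite gE.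
  apply: H => x' y x'I yB; rewrite gE /G /=.
  apply: le_trans (ler_norm _); apply: (hM (M + 1)); first by rewrite ltrDl.
  exists (x', y) => //; split => //=; move: x'I.
  by rewrite /= !in_itv /= => /andP[/ltW -> /ltW ->].
by split; [apply/cvg_ex; eexists; exact: H | exact: cvg_lim H].
Qed.
Lemma Rintegral01_derive (G g : R -> R) :
  (forall y, is_derive y (1 : R) G (g y)) -> continuous g ->
  \int[lebesgue_measure]_(y in `[0%R, 1%R]) g y = G 1 - G 0.
Proof.
move=> dG cg; rewrite /Rintegral (@continuous_FTC2 _ g G) //.
- exact: continuous_subspaceT.
- have cG : continuous G.
    by move=> x; apply/differentiable_continuous/derivable1_diffP; case: (dG x).
  split=> [x _||]; first by case: (dG x).
    by apply: cvg_at_right_filter; exact: cG.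
  by apply: cvg_at_left_filter; exact: cG.
- by move=> x _; rewrite derive1E; case: (dG x).
Qed.
End RealAnalysis.

(** * Derivatives of complex-valued functions of a real variable *)

Section ComplexValued.
Variable R : realType.

(** The boolean index lets one proof treat the real and the imaginary part together. *)
Definition part (b : bool) (z : R[i]) : R := if b then complex.Im z else complex.Re z.

Lemma part_continuous b : continuous (part b).
Proof. by case: b; [exact: Im_continuous | exact: Re_continuous]. Qed.

Lemma partD b z w : part b (z + w) = part b z + part b w.
Proof. by case: b; rewrite /part raddfD. Qed.

Lemma partN b z : part b (- z) = - part b z.
Proof. by case: b; rewrite /part raddfN. Qed.

Lemma partB b z w : part b (z - w) = part b z - part b w.
Proof. by case: b; rewrite /part raddfB. Qed.

Lemma part_sum b (I : Type) (r : seq I) (P : pred I) (F : I -> R[i]) :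
  part b (\sum_(i <- r | P i) F i) = \sum_(i <- r | P i) part b (F i).
Proof. by case: b; rewrite /part raddf_sum. Qed.

Lemma part_real b (x : R) z : part b (x%:C * z) = x * part b z.
Proof. by case: b z => -[z1 z2] /=; rewrite mul0r ?addr0 ?subr0. Qed.

Lemma part_eq z w : (forall b, part b z = part b w) -> z = w.
Proof. by move: z w => [z1 z2] [w1 w2] h; congr (_ +i* _); [exact: (h false) | exact: (h true)]. Qed.

Lemma part_le b z : (`|part b z|)%:C <= `|z|.
Proof.
case: b => /=; last exact: normc_ge_Re.
rewrite -[complex.Im z]opprK -ReiNIm normrN (le_trans (normc_ge_Re _)) // normrM.
by rewrite [`|'i%C|]normc_def /= expr0n /= add0r expr1n sqrtr1 mulr1.
Qed.

Lemma norm_le_parts z : `|z| <= (`|part false z| + `|part true z|)%:C.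
Proof.
rewrite {1}[z]complexE (le_trans (ler_normD _ _)) // rmorphD /= lerD //.
  by rewrite normc_def /= expr0n /= addr0 sqrtr_sqr.
rewrite normrM [`|'i%C|]normc_def /= expr0n /= add0r expr1n sqrtr1 mul1r.
by rewrite normc_def /= expr0n /= addr0 sqrtr_sqr.
Qed.

(* [R[i]] carries no structure of normed module over [R], hence the derivative of a
   complex-valued function of a real variable is taken componentwise. *)
Definition is_deriv1 (f : R -> R[i]) (t : R) (l : R[i]) : Prop :=
  forall b, is_derive t (1 : R) (fun s => part b (f s)) (part b l).

Lemma is_deriv1_eq f t l l' : is_deriv1 f t l -> l = l' -> is_deriv1 f t l'.
Proof. by move=> ? <-. Qed.

Lemma is_deriv1_cvg (f : R -> R[i]) t l :
  (x^-1)%:C * (f (x + t) - f t) @[x --> (0 : R)^'] --> l -> is_deriv1 f t l.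
Proof.
move=> h b; have h2 := cvg_comp _ (part b) h (@part_continuous b _).
set F := fun s => _.
have {}h2 : h^-1 *: (F (h *: 1 + t) - F t) @[h --> 0^'] --> part b l.
  apply: cvg_trans h2; apply: near_eq_cvg; apply: nearW => x /=.
  by rewrite /F part_real partB [x *: 1]mulr1.
by split; [apply/cvg_ex; eexists; exact: h2 | exact: cvg_lim h2].
Qed.

Lemma is_deriv1B f g t k l : is_deriv1 f t k -> is_deriv1 g t l ->
  is_deriv1 (fun s => f s - g s) t (k - l).
Proof.
move=> df dg b; rewrite partB; under eq_fun do rewrite partB.
exact: is_deriveB (df b) (dg b).
Qed.

Lemma is_deriv1_sum n (f : 'I_n -> R -> R[i]) t (l : 'I_n -> R[i]) :
  (forall i, is_deriv1 (f i) t (l i)) ->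
  is_deriv1 (fun s => \sum_i f i s) t (\sum_i l i).
Proof.
move=> df b; rewrite part_sum; under eq_fun do rewrite part_sum.
have := @is_derive_sum R R R n (fun i s => part b (f i s)) t 1 _ (fun i => df i b).
by rewrite fct_sumE.
Qed.

Lemma is_deriv1M f g t k l : is_deriv1 f t k -> is_deriv1 g t l ->
  is_deriv1 (fun s => f s * g s) t (k * g t + f t * l).
Proof.
have reM (z w : R[i]) : complex.Re (z * w)
  = complex.Re z * complex.Re w - complex.Im z * complex.Im w by case: z w => ? ? [].
have imM (z w : R[i]) : complex.Im (z * w)
  = complex.Re z * complex.Im w + complex.Im z * complex.Re w by case: z w => ? ? [].
move=> df dg [] /=.
  under eq_fun do rewrite imM.
  apply: is_derive_eq.
    exact: is_deriveD (is_deriveM (df false) (dg true)) (is_deriveM (df true) (dg false)).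
  by rewrite -/(part true (k * g t + f t * l)) partD /= !imM /GRing.scale /=; ring.
under eq_fun do rewrite reM.
apply: is_derive_eq.
  exact: is_deriveB (is_deriveM (df false) (dg false)) (is_deriveM (df true) (dg true)).
by rewrite -/(part false (k * g t + f t * l)) partD /= !reM /GRing.scale /=; ring.
Qed.

Lemma is_deriv1_affine (c d : R[i]) t : is_deriv1 (fun s => s%:C * c + d) t c.
Proof.
move=> b; under eq_fun do rewrite partD part_real.
have h : is_derive t (1 : R) (id * cst (part b c) + cst (part b d) : R -> R) (part b c).
  by apply: is_derive_eq; rewrite /= addr0 scaler0 add0r /GRing.scale /= mulr1.
exact: h.
Qed.
End ComplexValued.

(** * The 1-form of the vector field and its derivative along lines *)

Section SymplecticForm.
Variables (R : realType) (d : nat).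
Variables (Xq Xp : 'cV[R]_d -> 'cV[R[i]]_d -> 'cV[R[i]]_d).
Implicit Types (q u : 'cV[R]_d) (p v : 'cV[R[i]]_d).

(* The 1-form [Xq . dp - Xp . dq] at (q, p), evaluated on the tangent vector (u, v). *)
Definition omega q p u v : R[i] := dotc v (Xq q p) - dotc (cplx u) (Xp q p).

(* The derivative of [omega q p u v] in (q, p), in the direction (u', v'). *)
Definition Domega q p u' v' u v : R[i] :=
  dotc v (jac_q Xq q p *m cplx u' + jac_p Xq q p *m v')
  - dotc (cplx u) (jac_q Xp q p *m cplx u' + jac_p Xp q p *m v').

Lemma is_deriv1_field (X : 'cV[R]_d -> 'cV[R[i]]_d -> 'cV[R[i]]_d) q p u v s i :
  C1_field X ->
  is_deriv1 (fun s => X (s *: u + q) (s%:C *: v + p) i 0) s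
    ((jac_q X (s *: u + q) (s%:C *: v + p) *m cplx u
      + jac_p X (s *: u + q) (s%:C *: v + p) *m v) i 0).
Proof.
move=> CX; apply: is_deriv1_cvg.
have := derive_field (u := u) (v := v) (q := s *: u + q) (p := s%:C *: v + p) CX.
move=> h; have := cvg_comp _ (fun M : 'cV[R[i]]_d => M i 0) h (@coord_continuous _ _ _ _ _ _).
apply: cvg_trans; apply: near_eq_cvg; apply: nearW => x /=.
by rewrite !mxE scalerDl rmorphD /= scalerDl !addrA.
Qed.

Lemma is_deriv1_dotc (f g : R -> 'cV[R[i]]_d) t (k l : 'cV[R[i]]_d) :
  (forall i, is_deriv1 (fun s => f s i 0) t (k i 0)) ->
  (forall i, is_deriv1 (fun s => g s i 0) t (l i 0)) ->
  is_deriv1 (fun s => dotc (f s) (g s)) t (dotc k (g t) + dotc (f t) l).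
Proof.
move=> df dg; rewrite /dotc -big_split /=; apply: is_deriv1_sum => i.
exact: is_deriv1M.
Qed.

(** Base point and tangent vector both move affinely, so the product rule yields two terms: [omega]
    on the velocity of the tangent vector, and [Domega] from the motion of the base point. *)
Lemma is_deriv1_omega (q1 : 'cV[R]_d) (p1 : 'cV[R[i]]_d) u1 v1 q p u v s :
  C1_field Xq -> C1_field Xp ->
  is_deriv1 (fun s => omega (s *: u + q) (s%:C *: v + p) (s *: u1 + q1) (s%:C *: v1 + p1)) s
   (omega (s *: u + q) (s%:C *: v + p) u1 v1
    + Domega (s *: u + q) (s%:C *: v + p) u v (s *: u1 + q1) (s%:C *: v1 + p1)).
Proof.
move=> CXq CXp.
apply: is_deriv1_eq.
  apply: is_deriv1B; apply: is_deriv1_dotc => i.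
  - under eq_fun do rewrite 2!mxE.
    exact: is_deriv1_affine.
  - exact: is_deriv1_field.
  - under eq_fun do rewrite 3!mxE rmorphD rmorphM /=.
    have -> : (u1 i 0)%:C = cplx u1 i 0 by rewrite mxE.
    exact: is_deriv1_affine.
  - exact: is_deriv1_field.
by rewrite /omega /Domega opprD addrACA.
Qed.

Lemma cvg_dotc (T : Type) (F : set_system T) {FF : Filter F}
    (f g : T -> 'cV[R[i]]_d) (k l : 'cV[R[i]]_d) :
  f x @[x --> F] --> k -> g x @[x --> F] --> l -> dotc (f x) (g x) @[x --> F] --> dotc k l.
Proof.
move=> fk gl; apply: (@cvg_big _ _ +%R 0 _ add_continuous) => i _; apply: cvgM.
  by apply: (cvg_comp _ (fun M : 'cV[R[i]]_d => M i 0) fk); exact: coord_continuous.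
by apply: (cvg_comp _ (fun M : 'cV[R[i]]_d => M i 0) gl); exact: coord_continuous.
Qed.

Lemma cvg_mulmx (T : Type) (F : set_system T) {FF : Filter F}
    (f : T -> 'M[R[i]]_d) (g : T -> 'cV[R[i]]_d) (k : 'M[R[i]]_d) (l : 'cV[R[i]]_d) :
  f x @[x --> F] --> k -> g x @[x --> F] --> l -> f x *m g x @[x --> F] --> k *m l.
Proof.
move=> fk gl; apply: cvg_mx => i j; under eq_fun do rewrite mxE.
rewrite mxE; apply: (@cvg_big _ _ +%R 0 _ add_continuous) => m _; apply: cvgM.
  by apply: (cvg_comp _ (fun M : 'M[R[i]]_d => M i m) fk); exact: coord_continuous.
by apply: (cvg_comp _ (fun M : 'cV[R[i]]_d => M m j) gl); exact: coord_continuous.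
Qed.

(** The codomain [W] is left general so that this applies to the fields and to their Jacobians. *)
Lemma cvg_field (W : topologicalType) (X : 'cV[R]_d -> 'cV[R[i]]_d -> W)
   (T : Type) (F : set_system T) {FF : Filter F} (f : T -> 'cV[R]_d) g q p :
  continuous (fun z : 'cV[R]_d * 'cV[R[i]]_d => X z.1 z.2) ->
  f x @[x --> F] --> q -> g x @[x --> F] --> p -> X (f x) (g x) @[x --> F] --> X q p.
Proof.
move=> cX fq gp.
have cv : (f x, g x) @[x --> F] --> (q, p).
  exact: (@cvg_pair _ _ _ _ (nbhs q) (nbhs p) _ (nbhs_filter q) (nbhs_filter p)
    _ _ fq gp).
exact: cvg_comp _ _ cv (cX (q, p)).
Qed.

Lemma cvg_omega (T : Type) (F : set_system T) {FF : Filter F}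
    (fq fu : T -> 'cV[R]_d) (fp fv : T -> 'cV[R[i]]_d) q p u v :
  C1_field Xq -> C1_field Xp ->
  fq x @[x --> F] --> q -> fp x @[x --> F] --> p ->
  fu x @[x --> F] --> u -> fv x @[x --> F] --> v ->
  omega (fq x) (fp x) (fu x) (fv x) @[x --> F] --> omega q p u v.
Proof.
move=> [_ cXq _ _] [_ cXp _ _] hq hp hu hv.
have hXq := cvg_field (FF := FF) cXq hq hp; have hXp := cvg_field (FF := FF) cXp hq hp.
exact: (@cvgB _ _ _ _ FF _ _ _ _) (cvg_dotc (FF := FF) hv hXq) (cvg_dotc (FF := FF) (cvg_cplx (FF := FF) hu) hXp).
Qed.

Lemma cvg_Domega (T : Type) (F : set_system T) {FF : Filter F}
    (fq fu' fu : T -> 'cV[R]_d) (fp fv' fv : T -> 'cV[R[i]]_d) q p u' v' u v :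
  C1_field Xq -> C1_field Xp ->
  fq x @[x --> F] --> q -> fp x @[x --> F] --> p ->
  fu' x @[x --> F] --> u' -> fv' x @[x --> F] --> v' ->
  fu x @[x --> F] --> u -> fv x @[x --> F] --> v ->
  Domega (fq x) (fp x) (fu' x) (fv' x) (fu x) (fv x) @[x --> F] --> Domega q p u' v' u v.
Proof.
move=> [_ _ cXqq cXqp] [_ _ cXpq cXpp] hq hp hu' hv' hu hv.
have cu' := cvg_cplx (FF := FF) hu'.
have h1 := @cvgD _ _ _ _ FF _ _ _ _ (cvg_mulmx (FF := FF) (cvg_field (FF := FF) cXqq hq hp) cu') (cvg_mulmx (FF := FF) (cvg_field (FF := FF) cXqp hq hp) hv').
have h2 := @cvgD _ _ _ _ FF _ _ _ _ (cvg_mulmx (FF := FF) (cvg_field (FF := FF) cXpq hq hp) cu') (cvg_mulmx (FF := FF) (cvg_field (FF := FF) cXpp hq hp) hv').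
exact: (@cvgB _ _ _ _ FF _ _ _ _) (cvg_dotc (FF := FF) hv h1) (cvg_dotc (FF := FF) (cvg_cplx (FF := FF) hu) h2).
Qed.
End SymplecticForm.

(** * Closedness of the 1-form in coordinates *)

Section Integrability.
Variables (R : realType) (d : nat).
Variables (Xq Xp : 'cV[R]_d -> 'cV[R[i]]_d -> 'cV[R[i]]_d).
Implicit Types (q u : 'cV[R]_d) (p v : 'cV[R[i]]_d).

(** Vanishing of the exterior derivative of [omega]: its (p, p), (q, q) and mixed blocks, in this
    order. *)
Definition integrability : Prop := forall q p,
  [/\ (jac_p Xq q p)^T = jac_p Xq q p, (jac_q Xp q p)^T = jac_q Xp q p
    & jac_q Xq q p = - (jac_p Xp q p)^T].

Lemma dotc_trmx (x y : 'cV[R[i]]_d) (A : 'M[R[i]]_d) :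
  dotc x (A *m y) = dotc y (A^T *m x).
Proof.
have dotcE (z w : 'cV[R[i]]_d) : dotc z w = (z^T *m w) 0 0.
  by rewrite mxE; apply: eq_bigr => i _; rewrite mxE.
have trE (M : 'M[R[i]]_1) : M 0 0 = M^T 0 0 by rewrite mxE.
by rewrite !dotcE trE !trmx_mul trmxK mulmxA.
Qed.

Lemma dotcDr (x y z : 'cV[R[i]]_d) : dotc x (y + z) = dotc x y + dotc x z.
Proof. by rewrite /dotc -big_split; apply: eq_bigr => i _; rewrite mxE mulrDr. Qed.

Lemma dotcNr (x y : 'cV[R[i]]_d) : dotc x (- y) = - dotc x y.
Proof. by rewrite /dotc -sumrN; apply: eq_bigr => i _; rewrite mxE mulrN. Qed.

Lemma dotc0 (y : 'cV[R[i]]_d) : dotc 0 y = 0.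
Proof. by rewrite /dotc big1 // => i _; rewrite mxE mul0r. Qed.

(** Transposing across [dotc], the two diagonal blocks are symmetric bilinear forms, while the mixed
    terms are exchanged by the third identity. *)
Lemma Domega_sym q p u' v' u v : integrability ->
  Domega Xq Xp q p u' v' u v = Domega Xq Xp q p u v u' v'.
Proof.
move=> /(_ q p)[B C A]; rewrite /Domega !dotcDr.
rewrite [in LHS](dotc_trmx v _ (jac_p Xq q p)) [in LHS](dotc_trmx _ _ (jac_q Xp q p)).
rewrite B C A !mulNmx !dotcNr.
rewrite [in LHS](dotc_trmx _ _ (jac_p Xp q p)) [in RHS](dotc_trmx _ _ (jac_p Xp q p)).
move: (dotc _ _) (dotc _ _) (dotc _ _) (dotc _ _) => w x y z; ring.
Qed.
End Integrability.

(** * Poincare lemma for the explicit Hamiltonian, along lines *)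

Section ExplicitHamiltonian.
Variables (R : realType) (d : nat).
Variables (Xq Xp : 'cV[R]_d -> 'cV[R[i]]_d -> 'cV[R[i]]_d).
Implicit Types (q u : 'cV[R]_d) (p v : 'cV[R[i]]_d).
Hypotheses (CXq : C1_field Xq) (CXp : C1_field Xp).

(** The integrand of [explicit_H] is [omega] along the ray [l |-> l (q, p)], evaluated on its
    velocity (q, p). *)
Lemma part_explicit_H b q p :
  part b (explicit_H Xq Xp q p)
  = \int[lebesgue_measure]_(l in `[0%R, 1%R]) part b (omega Xq Xp (l *: q) (l%:C *: p) q p).
Proof. by case: b. Qed.

Lemma is_deriv1_explicit_H q p u v s : integrability Xq Xp ->
  is_deriv1 (fun t => explicit_H Xq Xp (t *: u + q) (t%:C *: v + p)) s
    (omega Xq Xp (s *: u + q) (s%:C *: v + p) u v).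
Proof.
move=> hint b; under eq_fun do rewrite part_explicit_H.
pose zq t := t *: u + q; pose zp (t : R) := t%:C *: v + p.
pose f t l := part b (omega Xq Xp (l *: zq t) (l%:C *: zp t) (zq t) (zp t)).
pose g t l := part b (omega Xq Xp (l *: zq t) (l%:C *: zp t) u v
  + Domega Xq Xp (l *: zq t) (l%:C *: zp t) (l *: u) (l%:C *: v) (zq t) (zp t)).
have df x y : is_derive x (1 : R) (f ^~ y) (g x y).
  (* For fixed [y], the scaled point again runs along a line, with direction scaled by [y], so that
     [is_deriv1_omega] applies. *)
  have E1 t : y *: zq t = t *: (y *: u) + y *: q.
    by rewrite scalerDr !scalerA mulrC.
  have E2 t : y%:C *: zp t = t%:C *: (y%:C *: v) + y%:C *: p.
    by rewrite scalerDr !scalerA mulrC.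
  rewrite /f /g; under eq_fun do rewrite E1 E2.
  rewrite E1 E2; exact: is_deriv1_omega.
have c1 : continuous (fun z : R * R => zq z.1).
  move=> z; apply: cvgD; last exact: cvg_cst.
  by apply: cvgZr_tmp; exact: cvg_fst.
have c1' : continuous (fun z : R * R => zp z.1).
  move=> z; apply: cvgD; last exact: cvg_cst.
  apply: cvgZr_tmp; apply: (cvg_comp (fun z : R * R => z.1)); first exact: cvg_fst.
  exact: real_complex_continuous.
have cl : continuous (fun z : R * R => z.2) by move=> z; exact: cvg_snd.
have cl' : continuous (fun z : R * R => (z.2)%:C).
  by move=> z; exact: cvg_comp _ _ (cl z) (@real_complex_continuous R _).
have c2 : continuous (fun z : R * R => z.2 *: zq z.1).
  by move=> z; apply: cvgZ; [exact: cl | exact: c1].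
have c2' : continuous (fun z : R * R => (z.2)%:C *: zp z.1).
  by move=> z; apply: cvgZ; [exact: cl' | exact: c1'].
have cf : continuous (fun z : R * R => f z.1 z.2).
  move=> z; have h := cvg_omega (FF := nbhs_filter z) CXq CXp (c2 z) (c2' z) (c1 z) (c1' z).
  exact: cvg_comp _ _ h (@part_continuous _ b _).
have cg : continuous (fun z : R * R => g z.1 z.2).
  move=> z; have cu : (x.2 *: u) @[x --> z] --> z.2 *: u by apply: cvgZr_tmp; exact: cl.
  have cv : ((x.2)%:C *: v) @[x --> z] --> (z.2)%:C *: v.
    by apply: cvgZr_tmp; exact: cl'.
  have cu0 : u @[_ --> z] --> u by exact: cvg_cst.
  have cv0 : v @[_ --> z] --> v by exact: cvg_cst.
  have h1 := cvg_omega (FF := nbhs_filter z) CXq CXp (c2 z) (c2' z) cu0 cv0.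
  have h2 := cvg_Domega (FF := nbhs_filter z) CXq CXp (c2 z) (c2' z) cu cv (c1 z) (c1' z).
  have h3 := @cvgD _ _ _ _ (nbhs_filter z) _ _ _ _ h1 h2.
  have h4 := cvg_comp _ _ h3 (@part_continuous _ b _).
  exact: h4.
have := is_derive_Rintegral01 s df cf cg.
suff -> : \int[lebesgue_measure]_(y in `[0%R, 1%R]) g s y
   = part b (omega Xq Xp (zq s) (zp s) u v) by [].
(* By symmetry of [Domega], [g s] is the derivative of [l |-> omega_(l z) (l w)]. *)
pose G l := part b (omega Xq Xp (l *: zq s) (l%:C *: zp s) (l *: u) (l%:C *: v)).
have dG y : is_derive y (1 : R) G (g s y).
  rewrite /g (Domega_sym _ _ _ _ _ _ hint) /G.
  have := is_deriv1_omega (Xq := Xq) (Xp := Xp) 0 0 u v 0 0 (zq s) (zp s) y CXq CXp b.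
  by rewrite !addr0; under eq_fun do rewrite !addr0.
(* [G 0] vanishes because the tangent vector [l (u, v)] does at [l = 0]; only [G 1] remains. *)
apply: etrans (Rintegral01_derive dG (continuous_slice (f := g) cg)) _.
rewrite /G !scale1r !scale0r /omega.
have -> : cplx (0 : 'cV[R]_d) = 0 by exact: map_mx0.
by rewrite !dotc0 -partB !subr0.
Qed.

End ExplicitHamiltonian.

(** * From mean value estimates to Frechet differentiability *)

Lemma differentiable_remainder (K : numFieldType) (V W : normedModType K) (f : V -> W)
    (l : {linear V -> W}) x : continuous l ->
  (forall e : K, 0 < e -> \forall u \near (0 : V), `|f (u + x) - f x - l u| <= e * `|u|) ->
  differentiable f x /\ 'd f x = l :> (V -> W).
Proof.
move=> cl hf.
have fo : f \o shift x = cst (f x) + l +o_ 0 id.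
  apply/eqaddoP => e e0; apply: filterS (hf e e0) => u.
  by rewrite opprD addrA.
have dE := diff_unique cl fo.
by split=> //; apply/diff_locallyP; rewrite dE.
Qed.

Section Pairing.
Variables (K : numFieldType) (d : nat).
Implicit Types c u q : 'cV[K]_d.

Lemma normm_coord u i : `|u i 0| <= `|u|.
Proof.
rewrite [X in _ <= X]mx_normE.
have -> : `|u i 0| = (`|u (i, 0 : 'I_1).1 (i, 0 : 'I_1).2|%:nng)%:num by [].
rewrite num_le; exact: (le_bigmax 0%:nng (fun k : 'I_d * 'I_1 => `|u k.1 k.2|%:nng)).
Qed.

(** The candidate differential with gradient [c], as a function of its own that can carry a linear
    structure; the field [K] is general, to be real for [q] and complex for [p]. *)
Definition pairing c u : K := \sum_j u j 0 * c j 0.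

Fact pairing_is_linear c : linear (pairing c).
Proof.
move=> a u v; rewrite /pairing scaler_sumr -big_split; apply: eq_bigr => j _.
by rewrite !mxE mulrDl -mulrA.
Qed.
HB.instance Definition _ c :=
  GRing.isLinear.Build K 'cV[K]_d K *:%R (pairing c) (pairing_is_linear c).

Lemma pairing_continuous c : continuous (pairing c).
Proof.
move=> u; apply: (@cvg_big _ _ +%R 0 _ add_continuous _ _ _ _ _ (nbhs_filter u)) => j _.
have h := @coord_continuous K d 1 j 0 u.
by apply: (@cvgMr_tmp _ _ _ (nbhs_filter u)); exact: h.
Qed.

Lemma pairing_delta c j : pairing c (delta_mx j 0) = c j 0.
Proof.
rewrite /pairing (bigD1 j) //= mxE !eqxx mul1r big1 ?addr0 // => k /negbTE kj.
by rewrite mxE kj mul0r.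
Qed.

Lemma ler_norm_pairing c u : `|pairing c u| <= d%:R * (`|c| * `|u|).
Proof.
rewrite (le_trans (ler_norm_sum _ _ _)) //.
have -> : d%:R * (`|c| * `|u|) = \sum_(j < d) `|c| * `|u|.
  by rewrite sumr_const card_ord mulr_natl.
rewrite ler_sum // => j _.
by rewrite normrM mulrC ler_pM // normm_coord.
Qed.

(* The two points account for the mean value theorem applied separately to the
   real and imaginary parts of a complex-valued function. *)
Lemma differentiable_mean_value (f : 'cV[K]_d -> K) (g : 'cV[K]_d -> 'cV[K]_d) q :
  {for q, continuous g} ->
  (forall u, exists c1 c2 : K, [/\ `|c1| <= 1, `|c2| <= 1 &
     `|f (u + q) - f q - pairing (g q) u|
       <= `|pairing (g (c1 *: u + q) - g q) u| + `|pairing (g (c2 *: u + q) - g q) u|]) ->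
  differentiable f q /\ 'd f q = pairing (g q) :> ('cV[K]_d -> K).
Proof.
move=> cg hf.
apply: (differentiable_remainder (@pairing_continuous (g q))) => e e0.
  (* Each of the two error terms is at most [d * e' * |u|]. The [+ 1] keeps the denominator positive
     when [d = 0]. *)
  pose e' := e / (2 * d%:R + 1).
  have D0 : 0 < 2 * d%:R + 1 :> K by rewrite ltr_wpDl // mulr_ge0.
  have e'0 : 0 < e' by rewrite divr_gt0.
  have ng := (@cvgrPdist_lt _ _ _ _ (nbhs_filter q) _ _).1 cg _ e'0.
  have [r /= r0 hr] := (nbhs_normP _ _).1 ng.
  apply/nbhs_norm0P; exists r => // u /= ur.
  have [c1 [c2 [c11 c21 le12]]] := hf u.
  (* As [|c| <= 1], the point [c *: u + q] stays as close to [q] as [u + q] does. *)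
  have gc (c : K) : `|c| <= 1 -> `|g (c *: u + q) - g q| <= e'.
    move=> c1'; rewrite distrC ltW //; apply: hr.
    rewrite /ball_ /= opprD addrCA subrr addr0 normrN normrZ.
    by apply: le_lt_trans ur; rewrite ler_piMl.
  apply: le_trans le12 _.
  have pc (c : K) : `|c| <= 1 -> `|pairing (g (c *: u + q) - g q) u| <= d%:R * (e' * `|u|).
    move=> c1'; apply: le_trans (ler_norm_pairing _ _) _.
    by rewrite ler_wpM2l // ler_wpM2r // gc.
  apply: le_trans (lerD (pc _ c11) (pc _ c21)) _.
  rewrite mulrA -mulrDl ler_wpM2r //.
  have -> : d%:R * e' + d%:R * e' = e * ((2 * d%:R) / (2 * d%:R + 1)).
    by rewrite /e'; ring.
  by rewrite ler_piMr ?(ltW e0) // ler_pdivrMr // mul1r lerDl.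
Qed.
End Pairing.

(** * Gradients of the explicit Hamiltonian *)

Section ExplicitIsHamiltonian.
Variables (R : realType) (d : nat).
Variables (Xq Xp : 'cV[R]_d -> 'cV[R[i]]_d -> 'cV[R[i]]_d).
Implicit Types (q u : 'cV[R]_d) (p v : 'cV[R[i]]_d).
Hypotheses (CXq : C1_field Xq) (CXp : C1_field Xp).

Lemma explicit_H_diff_q b q p : integrability Xq Xp ->
  differentiable (fun q => part b (explicit_H Xq Xp q p)) q /\
  forall j, 'D_(delta_mx j 0) (fun q => part b (explicit_H Xq Xp q p)) q
    = - part b (Xp q p j 0).
Proof.
move=> hint.
pose f q := part b (explicit_H Xq Xp q p).
pose g q : 'cV[R]_d := \col_j - part b (Xp q p j 0).
have cg : continuous g.
  move=> z; apply: (@cvg_mx _ _ _ (nbhs_filter z)) => i j; rewrite ord1 {j}; rewrite mxE; under eq_fun do rewrite mxE.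
  apply: (@cvgN _ _ _ _ (nbhs_filter z)).
  have h : Xp x p @[x --> z] --> Xp z p.
    case: CXp => _ cX _ _.
    by apply: (cvg_field (FF := nbhs_filter z) cX cvg_id); exact: cvg_cst.
  have h1 := cvg_comp _ (fun M : 'cV[R[i]]_d => M i 0) h (@coord_continuous _ _ _ _ _ _).
  exact: cvg_comp _ _ h1 (@part_continuous _ b _).
have hf u : exists c1 c2 : R, [/\ `|c1| <= 1, `|c2| <= 1 &
     `|f (u + q) - f q - pairing (g q) u|
       <= `|pairing (g (c1 *: u + q) - g q) u| + `|pairing (g (c2 *: u + q) - g q) u|].
  have dl s : is_derive s (1 : R) (fun t => f (t *: u + q)) (pairing (g (s *: u + q)) u).
    have := is_deriv1_explicit_H CXq CXp q p u 0 s hint b.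
    rewrite scaler0 add0r; under eq_fun do rewrite scaler0 add0r.
    suff -> : part b (omega Xq Xp (s *: u + q) p u 0) = pairing (g (s *: u + q)) u by [].
    rewrite /omega dotc0 sub0r partN /dotc part_sum -sumrN; apply: eq_bigr => j _.
    by rewrite !mxE part_real mulrN.
  have [c /andP[c0 c1] E] := MVT_quotient ler01 dl.
  (* The function is real-valued, so a single mean value point is used twice. *)
  exists c, c; rewrite ger0_norm //; split=> //.
  rewrite scale1r scale0r add0r mul1r in E.
  rewrite E -[X in X <= _]addr0 lerD //.
  have -> : pairing (g (c *: u + q) - g q) u = pairing (g (c *: u + q)) u - pairing (g q) u.
    by rewrite /pairing -sumrB; apply: eq_bigr => j _; rewrite !mxE mulrBr.
  by [].
have [df dE] := differentiable_mean_value (cg q) hf.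
split=> // j; by rewrite deriveE // dE pairing_delta mxE.
Qed.

(** Lines with a real parameter but arbitrary complex direction [v] suffice: the derivative along
    each is the complex-linear [pairing (g p) v], so the remainder estimate gives differentiability
    over [R[i]]. *)
Lemma explicit_H_diff_p q p : integrability Xq Xp ->
  differentiable (explicit_H Xq Xp q) p /\
  forall j, 'D_(delta_mx j 0) (explicit_H Xq Xp q) p = Xq q p j 0.
Proof.
move=> hint.
pose f := explicit_H Xq Xp q.
pose g p : 'cV[R[i]]_d := Xq q p.
have cg : continuous g.
  move=> z; case: CXq => _ cX _ _.
  by apply: (cvg_field (FF := nbhs_filter z) cX _ cvg_id); exact: cvg_cst.
have hf v : exists c1 c2 : R[i], [/\ `|c1| <= 1, `|c2| <= 1 &
     `|f (v + p) - f p - pairing (g p) v|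
       <= `|pairing (g (c1 *: v + p) - g p) v| + `|pairing (g (c2 *: v + p) - g p) v|].
  have dl b s : is_derive s (1 : R) (fun t => part b (f (t%:C *: v + p)))
      (part b (pairing (g (s%:C *: v + p)) v)).
    have := is_deriv1_explicit_H CXq CXp q p 0 v s hint b.
    rewrite scaler0 add0r; under eq_fun do rewrite scaler0 add0r.
    suff -> : omega Xq Xp q (s%:C *: v + p) 0 v = pairing (g (s%:C *: v + p)) v by [].
    have -> : omega Xq Xp q (s%:C *: v + p) 0 v = dotc v (Xq q (s%:C *: v + p)).
      by rewrite /omega /cplx map_mx0 dotc0 subr0.
    by [].
  have hc b : exists c : R[i], `|c| <= 1 /\
     part b (f (v + p) - f p - pairing (g p) v) = part b (pairing (g (c *: v + p) - g p) v).
    have [c /andP[c0 c1] E] := MVT_quotient ler01 (dl b).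
    exists c%:C; rewrite normc_def /= expr0n /= addr0 sqrtr_sqr ger0_norm // lecR; split=> //.
    rewrite rmorph1 scale1r rmorph0 scale0r add0r mul1r in E.
    have -> : pairing (g (c%:C *: v + p) - g p) v
       = pairing (g (c%:C *: v + p)) v - pairing (g p) v.
      by rewrite /pairing -sumrB; apply: eq_bigr => j _; rewrite !mxE mulrBr.
    by rewrite !partB E.
  have [c1 [c11 E1]] := hc false; have [c2 [c21 E2]] := hc true.
  exists c1, c2; split=> //; apply: le_trans (norm_le_parts _) _.
  by rewrite rmorphD /= -/(part false _) -/(part true _) lerD // ?E1 ?E2 part_le.
have [df dE] := differentiable_mean_value (cg p) hf.
by split=> // j; rewrite deriveE // dE pairing_delta.
Qed.

Lemma explicit_H_hamiltonian : integrability Xq Xp ->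
  is_hamiltonian_of Xq Xp (explicit_H Xq Xp).
Proof.
move=> hint; split.
- by move=> q p; split; [have [] := explicit_H_diff_q false q p hint
                        | have [] := explicit_H_diff_q true q p hint].
- by move=> q p; have [] := explicit_H_diff_p q p hint.
- move=> q p; split; apply/matrixP => j k; rewrite ord1 !mxE /partial_p /partial_q.
    by have [_ ->] := explicit_H_diff_p q p hint.
  have [_ h0] := explicit_H_diff_q false q p hint.
  have [_ h1] := explicit_H_diff_q true q p hint.
  rewrite h0 h1; apply: part_eq => b; rewrite partN; case: b => /=; by rewrite opprK.
Qed.
End ExplicitIsHamiltonian.

(** * Hamiltonian systems have a closed 1-form *)

Section HamiltonianIntegrability.
Variables (R : realType) (d : nat).
Variables (Xq Xp : 'cV[R]_d -> 'cV[R[i]]_d -> 'cV[R[i]]_d).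
Implicit Types (q u : 'cV[R]_d) (p v : 'cV[R[i]]_d).
Hypotheses (CXq : C1_field Xq) (CXp : C1_field Xp).

Lemma is_deriv1_omega_cst u1 v1 u v q p s :
  is_deriv1 (fun s => omega Xq Xp (s *: u + q) (s%:C *: v + p) u1 v1) s
   (Domega Xq Xp (s *: u + q) (s%:C *: v + p) u v u1 v1).
Proof.
have := is_deriv1_omega u1 v1 0 0 q p u v s CXq CXp.
rewrite !scaler0 !add0r.
have -> : omega Xq Xp (s *: u + q) (s%:C *: v + p) 0 0 = 0.
  by rewrite /omega /cplx map_mx0 !dotc0 subr0.
by rewrite add0r; under eq_fun do rewrite !scaler0 !add0r.
Qed.

(* [H] is only assumed to be separately differentiable, so its derivative along a
   line is available a priori only for lines parallel to a factor. *)
Lemma is_deriv1_hamiltonian (H : 'cV[R]_d -> 'cV[R[i]]_d -> R[i]) u v q p s :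
  is_hamiltonian_of Xq Xp H -> u = 0 \/ v = 0 ->
  is_deriv1 (fun t => H (t *: u + q) (t%:C *: v + p)) s
    (omega Xq Xp (s *: u + q) (s%:C *: v + p) u v).
Proof.
move=> [dq dp XH] [-> | ->]; rewrite scaler0 add0r; under eq_fun do rewrite scaler0 add0r.
  apply: is_deriv1_cvg.
  have := line_complex (v := v) (dp q (s%:C *: v + p)).
  rewrite Defs.derive_sum; last exact: dp.
  have -> : omega Xq Xp q (s%:C *: v + p) 0 v
     = \sum_j v j 0 * 'D_(delta_mx j 0) (H q) (s%:C *: v + p).
    rewrite /omega /cplx map_mx0 dotc0 subr0 (XH _ _).1; apply: eq_bigr => j _.
    by rewrite mxE.
  apply: cvg_trans; apply: near_eq_cvg; apply: nearW => x /=.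
  by rewrite rmorphD /= scalerDl addrA.
move=> b.
have db q' : differentiable (fun q' => part b (H q' p)) q'.
  by case: b; [exact: (dq q' p).2 | exact: (dq q' p).1].
have := derivable_line (u := u) (db (s *: u + q)).
rewrite Defs.derive_sum //.
suff -> : part b (omega Xq Xp (s *: u + q) p u 0) =
  \sum_j u j 0 * 'D_(delta_mx j 0) (fun q' => part b (H q' p)) (s *: u + q) by [].
rewrite /omega dotc0 sub0r (XH _ _).2 partN /dotc part_sum -sumrN.
apply: eq_bigr => j _; rewrite !mxE part_real partN mulrN opprK.
by case: b {db}.
Qed.

(** On the plane through (q, p) spanned by the two directions, [H] has first derivatives given by
    [omega] and mixed second derivatives given by [Domega]; these agree at the origin of the
    plane. *)
Lemma Domega_sym_hamiltonian (H : 'cV[R]_d -> 'cV[R[i]]_d -> R[i]) q p u1 v1 u2 v2 :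
  is_hamiltonian_of Xq Xp H -> u1 = 0 \/ v1 = 0 -> u2 = 0 \/ v2 = 0 ->
  Domega Xq Xp q p u2 v2 u1 v1 = Domega Xq Xp q p u1 v1 u2 v2.
Proof.
move=> hH D1 D2; apply: part_eq => b.
pose zq s t := s *: u1 + (t *: u2 + q).
pose zp (s t : R) := s%:C *: v1 + (t%:C *: v2 + p).
(* Reordering the sum shows the plane as ruled by lines in the second direction. *)
have zqC s t : zq s t = t *: u2 + (s *: u1 + q) by exact: addrCA.
have zpC s t : zp s t = t%:C *: v2 + (s%:C *: v1 + p) by exact: addrCA.
pose g s t := part b (H (zq s t) (zp s t)).
pose g1 s t := part b (omega Xq Xp (zq s t) (zp s t) u1 v1).
pose g2 s t := part b (omega Xq Xp (zq s t) (zp s t) u2 v2).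
pose g12 s t := part b (Domega Xq Xp (zq s t) (zp s t) u2 v2 u1 v1).
pose g21 s t := part b (Domega Xq Xp (zq s t) (zp s t) u1 v1 u2 v2).
have d1 (s t : R) : is_derive s (1 : R) (g ^~ t) (g1 s t) by exact: is_deriv1_hamiltonian.
have d2 (s t : R) : is_derive t (1 : R) (g s) (g2 s t).
  rewrite /g2 zqC zpC.
  have := is_deriv1_hamiltonian (s *: u1 + q) (s%:C *: v1 + p) t hH D2 b.
  by under eq_fun do rewrite -zqC -zpC.
have d12 (s t : R) : is_derive t (1 : R) (g1 s) (g12 s t).
  rewrite /g12 zqC zpC.
  have := is_deriv1_omega_cst u1 v1 u2 v2 (s *: u1 + q) (s%:C *: v1 + p) t b.
  by under eq_fun do rewrite -zqC -zpC.
have d21 (s t : R) : is_derive s (1 : R) (g2 ^~ t) (g21 s t).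
  exact: is_deriv1_omega_cst.
have cf : {for (0, 0), continuous (fun z : R * R => z.1)} by exact: cvg_fst.
have cs : {for (0, 0), continuous (fun z : R * R => z.2)} by exact: cvg_snd.
have cfC : {for (0, 0), continuous (fun z : R * R => (z.1)%:C)}.
  exact: cvg_comp _ _ cf (@real_complex_continuous R _).
have csC : {for (0, 0), continuous (fun z : R * R => (z.2)%:C)}.
  exact: cvg_comp _ _ cs (@real_complex_continuous R _).
pose FF := nbhs_filter ((0, 0) : R * R).
have cq : {for (0, 0), continuous (fun z : R * R => zq z.1 z.2)}.
  apply: (@cvgD _ _ _ _ FF); first exact: (@cvgZr_tmp _ _ _ _ FF).
  by apply: (@cvgD _ _ _ _ FF); [exact: (@cvgZr_tmp _ _ _ _ FF) | exact: (@cvg_cst _ _ _ _ FF)].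
have cp : {for (0, 0), continuous (fun z : R * R => zp z.1 z.2)}.
  apply: (@cvgD _ _ _ _ FF); first exact: (@cvgZr_tmp _ _ _ _ FF).
  by apply: (@cvgD _ _ _ _ FF); [exact: (@cvgZr_tmp _ _ _ _ FF) | exact: (@cvg_cst _ _ _ _ FF)].
have cD u v u' v' : {for (0, 0), continuous (fun z : R * R =>
    part b (Domega Xq Xp (zq z.1 z.2) (zp z.1 z.2) u' v' u v))}.
  have ku : u @[_ --> nbhs ((0, 0) : R * R)] --> u by exact: (@cvg_cst _ _ _ _ FF).
  have kv : v @[_ --> nbhs ((0, 0) : R * R)] --> v by exact: (@cvg_cst _ _ _ _ FF).
  have ku' : u' @[_ --> nbhs ((0, 0) : R * R)] --> u' by exact: (@cvg_cst _ _ _ _ FF).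
  have kv' : v' @[_ --> nbhs ((0, 0) : R * R)] --> v' by exact: (@cvg_cst _ _ _ _ FF).
  have h := cvg_Domega (FF := FF) CXq CXp cq cp ku' kv' ku kv.
  exact: cvg_comp _ _ h (@part_continuous _ b _).
have := mixed_derivatives_eq d1 d2 d12 d21 (cD _ _ _ _) (cD _ _ _ _).
by rewrite /g12 /g21 /zq /zp !scale0r !add0r.
Qed.

(** Pairs of basis vectors, both along [p], both along [q], or one along each, read off the entries
    of the three blocks. *)
Lemma integrability_Domega :
  (forall q p u1 v1 u2 v2, u1 = 0 \/ v1 = 0 -> u2 = 0 \/ v2 = 0 ->
    Domega Xq Xp q p u2 v2 u1 v1 = Domega Xq Xp q p u1 v1 u2 v2) ->
  integrability Xq Xp.
Proof.
have dE (y : 'cV[R[i]]_d) j : dotc (delta_mx j 0) y = y j 0.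
  rewrite /dotc (bigD1 j) //= mxE !eqxx mul1r big1 ?addr0 // => k /negbTE kj.
  by rewrite mxE kj mul0r.
have mE (A : 'M[R[i]]_d) i j : (A *m (delta_mx j 0 : 'cV_d)) i 0 = A i j.
  by rewrite -colE mxE.
have cE j : cplx (delta_mx j 0 : 'cV[R]_d) = delta_mx j 0 by exact: map_delta_mx.
have c0 : cplx (0 : 'cV[R]_d) = 0 by exact: map_mx0.
move=> hD q p; split; apply/matrixP => i j; rewrite !mxE.
- have := hD q p 0 (delta_mx j 0) 0 (delta_mx i 0) (or_introl erefl) (or_introl erefl).
  by rewrite /Domega c0 !dotc0 !mulmx0 !add0r !subr0 !dE !mE !mxE.
- have := hD q p (delta_mx j 0) 0 (delta_mx i 0) 0 (or_intror erefl) (or_intror erefl).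
  rewrite /Domega !cE !dotc0 !mulmx0 !addr0 !sub0r !dE !mE !mxE.
  by move/oppr_inj.
- have L : Domega Xq Xp q p (delta_mx j 0) 0 0 (delta_mx i 0) = jac_q Xq q p i j.
    rewrite /Domega c0 cE; move: (jac_q Xq q p) (jac_p Xq q p) => A B.
    by rewrite dotc0 subr0 (mulmx0 _ B) addr0 dE mE.
  have L' : Domega Xq Xp q p 0 (delta_mx i 0) (delta_mx j 0) 0 = - jac_p Xp q p j i.
    by rewrite /Domega c0 cE dotc0 sub0r !mulmx0 add0r dE mE.
  have := hD q p 0 (delta_mx i 0) (delta_mx j 0) 0 (or_introl erefl) (or_intror erefl).
  by rewrite L L' !mxE.
Qed.

Lemma hamiltonian_integrability : hamiltonian_system Xq Xp -> integrability Xq Xp.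
Proof.
by move=> [H hH]; apply: integrability_Domega => *; exact: Domega_sym_hamiltonian hH _ _.
Qed.
End HamiltonianIntegrability.

(** * Quantum derivatives of classically differentiable functions *)

Section BoxClassical.
Variables (R : realType) (d : nat) (I : set R) (mu : R[i]).
Variable E : set (R * R -> 'cV[R]_d).
Hypotheses (oI : open I) (hE : complementary I E).

(** The real and imaginary parts of [g] lie in the convergent subspace, so the projection along [E]
    fixes them on the slab. *)
Lemma mean_lim (g : R * R -> 'cV[R[i]]_d) (l : 'cV[R[i]]_d) t :
  {within slab I, continuous g} ->
  (forall s, I s -> cvg (g (s, e) @[e --> 0^'+])) -> I t ->
  g (t, e) @[e --> 0^'+] --> l -> mean I E g t = l.
Proof.
move=> cg gl It gt; have [CR CI] := C0_ReIm cg.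
have KR : C0conv I (mxRe \o g).
  split=> // s /gl /cvg_ex[m gm]; apply/cvg_ex; exists (mxRe m).
  exact: cvg_comp _ _ gm (@mxRe_continuous _ _ _ _).
have KI : C0conv I (mxIm \o g).
  split=> // s /gl /cvg_ex[m gm]; apply/cvg_ex; exists (mxIm m).
  exact: cvg_comp _ _ gm (@mxIm_continuous _ _ _ _).
apply: cvg_lim => //; apply: cvg_trans gt; apply: near_eq_cvg.
apply: filterS (near_slab It) => e se.
by rewrite /conv_partC !(conv_part_id hE) //= -mxReImE.
Qed.

(** Both one-sided quotients tend to [f']: their half-sum does too, and the term carrying [mu] tends
    to 0. *)
Lemma boxR_derivable (f f' : R -> 'cV[R]_d) t :
  {within I, continuous f} ->
  (forall s, I s -> dplus f e s @[e --> 0^'+] --> f' s) ->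
  (forall s, I s -> dminus f e s @[e --> 0^'+] --> f' s) ->
  I t -> boxR I mu E f t = cplx (f' t).
Proof.
move=> cf fp fm It.
have lim_box s : I s -> box_epsR mu f (step I s e) s @[e --> 0^'+] --> cplx (f' s).
  move=> Is.
  have -> : cplx (f' s) = 2^-1 *: (cplx (f' s + f' s) + ('i%C * mu) *: cplx (f' s - f' s)).
    by apply/matrixP => i j; rewrite !mxE subrr rmorphD rmorph0 /=; field.
  have h : box_epsR mu f e s @[e --> 0^'+] -->
      2^-1 *: (cplx (f' s + f' s) + ('i%C * mu) *: cplx (f' s - f' s)).
    apply: cvgZl_tmp; apply: cvgD; last apply: cvgZl_tmp; apply: cvg_cplx.
      exact: cvgD (fp _ Is) (fm _ Is).
    exact: cvgB (fp _ Is) (fm _ Is).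
  (* For small [e] the truncated step is [e] itself. *)
  apply: cvg_trans h; apply: near_eq_cvg.
  by apply: filterS (step_near oI Is) => e ->.
have lim_ex s Is := cvgP _ (lim_box s Is).
exact: (@mean_lim (fun z : R * R => box_epsR mu f (step I z.1 z.2) z.1) _ t
  (@box_epsR_cont R d I mu oI f cf) lim_ex It (lim_box t It)).
Qed.

Lemma boxC_cplx (f : R -> 'cV[R]_d) : boxC I mu E (fun t => cplx (f t)) = boxR I mu E f.
Proof.
rewrite /boxC /boxR; congr (mean I E); apply/funext => z; rewrite /box_epsC.
have -> : mxRe \o (fun t => cplx (f t)) = f.
  by apply/funext => t; apply/matrixP => i j; rewrite !mxE.
have -> : mxIm \o (fun t => cplx (f t)) = fun=> 0.
  by apply/funext => t; apply/matrixP => i j; rewrite !mxE.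
rewrite [X in _ + 'i%C *: X](_ : _ = 0) ?scaler0 ?addr0 //.
by rewrite /box_epsR /dplus /dminus !(subrr, addr0, scaler0) /cplx map_mx0 scaler0 addr0 scaler0.
Qed.

Lemma boxC_cst (p : 'cV[R[i]]_d) t : I t -> boxC I mu E (fun=> p) t = 0.
Proof.
have e0 (w : 'cV[R]_d) e s : box_epsR mu (fun=> w) e s = 0.
  by rewrite /box_epsR /dplus /dminus !(subrr, addr0, scaler0) /cplx map_mx0 scaler0 addr0 scaler0.
have e1 : (fun z : R * R => box_epsC mu (fun=> p) (step I z.1 z.2) z.1) = fun=> 0.
  by apply/funext => z; rewrite /box_epsC !e0 scaler0 addr0.
rewrite /boxC e1 => It.
have c0 : {within slab I, continuous (fun=> 0 : 'cV[R[i]]_d)} by move=> z; exact: cvg_cst.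
have l0 : (0 : 'cV[R[i]]_d) @[_ --> (0 : R)^'+] --> (0 : 'cV[R[i]]_d) by exact: cvg_cst.
apply: (@mean_lim (fun=> 0) _ _ c0 _ It l0) => s _; exact: cvgP l0.
Qed.

Lemma boxR_cst (q : 'cV[R]_d) t : I t -> boxR I mu E (fun=> q) t = 0.
Proof. by rewrite -boxC_cplx; exact: boxC_cst. Qed.

End BoxClassical.

(** * Holder classes *)

Section Holder.
Variables (R : realType) (d : nat) (I : set R) (alpha : R).
Hypothesis (alpha01 : 0 < alpha < 1).

(** The maximum is attained at some entry, whose modulus the embedding preserves. *)
Lemma norm_cplx (x : 'cV[R]_d) : `|cplx x| <= `|x|%:C.
Proof.
have [->|/mx_norm_neq0[[i j] /= h]] := eqVneq (`|cplx x|) 0; first by rewrite lecR.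
by rewrite [X in X <= _]h ord1 mxE normc_def /= expr0n /= addr0 sqrtr_sqr lecR normm_coord.
Qed.

(** Quantum derivatives are computed only at points of [I], and the Holder condition sees no
    others. *)
Lemma holderC_eq (f g : R -> 'cV[R[i]]_d) :
  (forall t, I t -> f t = g t) -> holderC I alpha g -> holderC I alpha f.
Proof.
move=> fg [cg hg]; split.
  have e : {in I, g =1 f} by move=> t /set_mem It; rewrite fg.
  exact: (subspace_eq_continuous e cg).
move=> t It; have [e [c [e0 c0 h]]] := hg t It; exists e, c; split=> // s Is ts.
by rewrite !fg //; exact: h.
Qed.

Lemma holderC_cplx (f : R -> 'cV[R]_d) :
  holderR I alpha f -> holderC I alpha (fun t => cplx (f t)).
Proof.
move=> [cf hf]; split.
  by move=> t; exact: cvg_comp _ _ (cf t) (@cplx_continuous R d 1 _).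
move=> t It; have [e [c [e0 c0 h]]] := hf t It; exists e, c; split=> // s Is ts.
by rewrite -cplxB (le_trans (norm_cplx _)) // lecR; exact: h.
Qed.

Lemma holderC_cst (p : 'cV[R[i]]_d) : holderC I alpha (fun=> p).
Proof.
split; first by move=> t; exact: cvg_cst.
move=> t It; exists 1, 1; split=> // s _ _.
by rewrite subrr normr0 mul1r lecR powR_ge0.
Qed.

Lemma holderR_scale (phi : R -> R) (w : 'cV[R]_d) :
  continuous phi ->
  (forall t, exists2 L, 0 < L & forall s, `|t - s| <= 1 -> `|phi t - phi s| <= L * `|t - s|) ->
  holderR I alpha (fun t => phi t *: w).
Proof.
move=> cphi hphi; split.
  by apply: continuous_subspaceT => t; apply: cvgZr_tmp; exact: cphi.
move=> t It; have [L L0 hL] := hphi t.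
have c0 : 0 < L * (`|w| + 1) by rewrite mulr_gt0 // ltr_wpDl.
(* The [+ 1] keeps the Holder constant positive when [w = 0]. *)
exists 1, (L * (`|w| + 1)); split=> // s _ ts.
rewrite -scalerBl normrZ.
(* Lipschitz implies Holder at distance at most 1, since there [x <= x ^ alpha]. *)
have h1 : `|t - s| <= `|t - s| `^ alpha.
  have [->|ts0] := eqVneq (`|t - s|) 0; first exact: powR_ge0.
  rewrite -[X in X <= _]powRr1 //; apply: ger_powR.
    by rewrite lt_def ts0 normr_ge0 ts.
  by case/andP: alpha01 => _ /ltW.
have := hL s ts.
move=> h2; apply: (@le_trans _ _ (L * `|t - s| * (`|w| + 1))).
  by apply: ler_pM => //; rewrite lerDl.
rewrite mulrAC ler_wpM2l //; exact: ltW.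
Qed.
End Holder.

(** * Self-adjointness tested on bump variations *)

Section SelfAdjoint.
Variables (R : realType) (d : nat) (I : set R) (a b : R) (mu : R[i]).
Variables (E : set (R * R -> 'cV[R]_d)) (alpha beta : R).
Variables (Xq Xp : 'cV[R]_d -> 'cV[R[i]]_d -> 'cV[R[i]]_d).
Hypotheses (oI : open I) (ltab : a < b) (abI : `[a, b]%classic `<=` I).
Hypotheses (hE : complementary I E).
Hypotheses (alpha01 : 0 < alpha < 1) (beta01 : 0 < beta < 1).

(** It vanishes at [a] and [b], as variations must, and is positive in between. *)
Let bump (t : R) := (t - a) * (b - t).

Lemma bump_continuous : continuous bump.
Proof.
move=> t; apply: cvgM; first by apply: cvgB; [exact: cvg_id | exact: cvg_cst].
by apply: cvgB; [exact: cvg_cst | exact: cvg_id].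
Qed.

Lemma holder_bump gamma w : 0 < gamma < 1 -> holderR I gamma (fun t => bump t *: w : 'cV[R]_d).
Proof.
move=> g01; apply: holderR_scale => //; first exact: bump_continuous.
(* From [bump t - bump s = (bump' t + (t - s)) (t - s)] with [|t - s| <= 1]. *)
move=> t; exists (`|a + b - 2 * t| + 1); first by rewrite ltr_wpDl.
move=> s ts.
have -> : bump t - bump s = (a + b - 2 * t + (t - s)) * (t - s) by rewrite /bump; ring.
by rewrite normrM ler_wpM2r // (le_trans (ler_normD _ _)) // lerD2l.
Qed.

Let dbump (t : R) := a + b - 2 * t.

Lemma holder_dbump gamma w : 0 < gamma < 1 -> holderR I gamma (fun t => dbump t *: w : 'cV[R]_d).
Proof.
move=> g01; apply: holderR_scale => //.
  move=> t; apply: cvgB; first exact: cvg_cst.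
  by apply: cvgMl_tmp; exact: cvg_id.
move=> t; exists 2 => // s ts.
have -> : dbump t - dbump s = - (2 * (t - s)) by rewrite /dbump; ring.
by rewrite normrN normrM ger0_norm.
Qed.

Lemma box_bump (w : 'cV[R]_d) t : I t ->
  boxR I mu E (fun t => bump t *: w) t = cplx (dbump t *: w).
Proof.
move=> It.
have cb : {within I, continuous (fun t => bump t *: w)} by have [] := holder_bump w alpha01.
(* [bump] is quadratic, so its forward and backward quotients are exactly [dbump s - e] and
   [dbump s + e]. *)
have lim (k s : R) : (dbump s + k * e) *: w @[e --> 0^'+] --> dbump s *: w.
  have -> : dbump s *: w = (dbump s + k * 0) *: w by rewrite mulr0 addr0.
  apply: cvgZr_tmp; apply: cvgD; first exact: cvg_cst.
  apply: cvgMl_tmp; apply: cvg_at_right_filter; exact: cvg_id.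
apply: (@boxR_derivable _ _ _ _ _ oI hE (fun t => bump t *: w) (fun t => dbump t *: w)) => //.
  move=> s _; apply: cvg_trans (lim (-1) s); apply: near_eq_cvg.
  near=> e; rewrite /dplus -scalerBl scalerA; congr (_ *: _).
  have e0 : e != 0 by near: e; exact: nbhs_right_neq.
  by rewrite /bump /dbump; field.
move=> s _; apply: cvg_trans (lim 1 s); apply: near_eq_cvg.
near=> e; rewrite /dminus -scalerBl scalerA; congr (_ *: _).
have e0 : e != 0 by near: e; exact: nbhs_right_neq.
by rewrite /bump /dbump; field.
Unshelve. all: by end_near. Qed.

(** Constant curves make every point (q, p) available for evaluating the Jacobians. *)
Lemma admissible_cst (q : 'cV[R]_d) (p : 'cV[R[i]]_d) :
  admissible I mu E alpha (fun=> q) (fun=> p).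
Proof.
split.
- have -> : (fun=> q) = (fun=> 1 *: q) :> (R -> _) by rewrite scale1r.
  apply: (holderR_scale I alpha01 (phi := fun=> 1)); first exact: cst_continuous.
  by move=> t; exists 1 => // s _; rewrite subrr normr0 mul1r.
- exact: holderC_cst.
- apply: (holderC_eq (g := fun=> 0)); last exact: holderC_cst.
  by move=> t It; exact: boxR_cst.
- apply: (holderC_eq (g := fun=> 0)); last exact: holderC_cst.
  by move=> t It; exact: boxC_cst.
Qed.

Lemma holder_box_bump (w : 'cV[R]_d) :
  holderC I alpha (boxR I mu E (fun t => bump t *: w)).
Proof.
apply: (holderC_eq (g := fun t => cplx (dbump t *: w))); first exact: box_bump.
exact: holderC_cplx (holder_dbump w alpha01).
Qed.

Lemma bump_ends (w : 'cV[R]_d) : bump a *: w = 0 /\ bump b *: w = 0.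
Proof. by rewrite /bump !subrr mulr0 mul0r !scale0r. Qed.

Lemma holder0R_bump (w : 'cV[R]_d) : holder0R I a b beta (fun t => bump t *: w).
Proof. by have [h1 h2] := bump_ends w; split=> //; exact: holder_bump. Qed.

Lemma admissible_var_q (w : 'cV[R]_d) :
  admissible_var I mu E a b alpha beta (fun t => bump t *: w) (fun=> 0).
Proof.
split; [exact: holder0R_bump | | exact: holder_box_bump | ].
- by split=> //; exact: holderC_cst.
- apply: (holderC_eq (g := fun=> 0)); last exact: holderC_cst.
  by move=> t It; exact: boxC_cst.
Qed.

Lemma admissible_var_p (w : 'cV[R]_d) :
  admissible_var I mu E a b alpha beta (fun=> 0) (fun t => cplx (bump t *: w)).
Proof.
(* The zero variation is treated as the bump variation with [w = 0]. *)
have z : (fun=> 0) = (fun t => bump t *: 0) :> (R -> 'cV[R]_d).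
  by apply/funext => t; rewrite scaler0.
split; [by rewrite z; exact: holder0R_bump | | by rewrite z; exact: holder_box_bump | ].
- have [h1 h2] := bump_ends w; split; last 2 first.
  + by rewrite h1 /cplx map_mx0.
  + by rewrite h2 /cplx map_mx0.
  + exact: holderC_cplx (holder_bump w beta01).
- by rewrite boxC_cplx; exact: holder_box_bump.
Qed.

(** Basis vectors scaled by [c], to be the value of the bump, still determine the columns. *)
Lemma mulmx_delta_inj (A B : 'M[R[i]]_d) (c : R) : c != 0 ->
  (forall j, A *m cplx (c *: delta_mx j 0 : 'cV[R]_d) = B *m cplx (c *: delta_mx j 0 : 'cV[R]_d)) ->
  A = B.
Proof.
move=> c0 AB; have cC0 : c%:C != 0 by rewrite -(rmorph0 (real_complex R)) (inj_eq (@complexI R)).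
apply/matrixP => i j; have := AB j.
have -> : cplx (c *: delta_mx j 0 : 'cV[R]_d) = c%:C *: (delta_mx j 0).
  by rewrite cplxZ; congr (_ *: _); exact: map_delta_mx.
rewrite -!scalemxAr => /(scalerI cC0) /(congr1 (fun M : 'cV[R[i]]_d => M i 0)).
by rewrite -!colE !mxE.
Qed.

(** [y] and [w] stand for the quantum derivatives, which both operators share; only the Jacobian
    terms have to match. *)
Lemma block_adjoint (A B C D : 'M[R[i]]_d) (x y v w : 'cV[R[i]]_d) :
  B^T = B -> C^T = C -> A = - D^T ->
  col_mx (y - A *m x - B *m v) (w - C *m x - D *m v)
  = col_mx (y + D^T *m x - B^T *m v) (w - C^T *m x + A^T *m v).
Proof.
move=> -> -> ->.
by rewrite mulNmx opprK [(- _)^T]linearN /= trmxK mulNmx.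
Qed.

Lemma block_adjoint_q (A B C D : 'M[R[i]]_d) (x y w : 'cV[R[i]]_d) :
  col_mx (y - A *m x - B *m 0) (w - C *m x - D *m 0)
  = col_mx (y + D^T *m x - B^T *m 0) (w - C^T *m x + A^T *m 0) ->
  A *m x = - D^T *m x /\ C *m x = C^T *m x.
Proof.
rewrite (mulmx0 _ A^T) (mulmx0 _ B) (mulmx0 _ B^T) (mulmx0 _ D) !subr0 addr0.
move=> /eq_col_mx[/addrI h /addrI/oppr_inj ->]; split=> //.
by rewrite mulNmx -h opprK.
Qed.

Lemma block_adjoint_p (A B C D : 'M[R[i]]_d) (y v w : 'cV[R[i]]_d) :
  col_mx (y - A *m 0 - B *m v) (w - C *m 0 - D *m v)
  = col_mx (y + D^T *m 0 - B^T *m v) (w - C^T *m 0 + A^T *m v) ->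
  B *m v = B^T *m v.
Proof.
rewrite (mulmx0 _ A) (mulmx0 _ D^T) subr0 addr0.
by move=> /eq_col_mx[/addrI/oppr_inj -> _].
Qed.

Lemma selfadjoint_integrability :
  selfadjoint_derivative I mu E Xq Xp a b alpha beta <-> integrability Xq Xp.
Proof.
split=> [sa q p | hint q p u v _ _ t It]; last first.
  by have [B C A] := hint (q t) (p t); exact: block_adjoint.
(* At the midpoint the bump equals [((b - a) / 2) ^ 2], which is nonzero. *)
pose t0 := (a + b) / 2.
have It0 : I t0 by apply: abI; rewrite /= in_itv /= /t0; move: ltab; lra.
have c0 : bump t0 != 0.
  have -> : bump t0 = ((b - a) / 2) ^+ 2 by rewrite /bump /t0; field.
  by rewrite expf_neq0 // mulf_neq0 ?invr_eq0 ?pnatr_eq0 // subr_eq0 gt_eqF.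
have saq j := block_adjoint_q
  (sa _ _ _ _ (admissible_cst q p) (admissible_var_q (delta_mx j 0)) t0 It0).
have sap j := sa _ _ _ _ (admissible_cst q p) (admissible_var_p (delta_mx j 0)) t0 It0.
have cplx0 : cplx (0 : 'cV[R]_d) = 0 by exact: map_mx0.
split.
- apply/esym; apply: (mulmx_delta_inj c0) => j; have := sap j.
  by rewrite /Dqop /Dqop_adj cplx0 => /block_adjoint_p.
- by apply/esym; apply: (mulmx_delta_inj c0) => j; have [] := saq j.
- by apply: (mulmx_delta_inj c0) => j; have [] := saq j.
Qed.

End SelfAdjoint.

Theorem theorem30 (R : realType) (d : nat) (I : set R) (a b : R) (mu : R[i])
    (E : set (R * R -> 'cV[R]_d)) (alpha beta : R)
    (Xq Xp : 'cV[R]_d -> 'cV[R[i]]_d -> 'cV[R[i]]_d)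
    (d_gt0 : (0 < d)%N) (openI : open I) (ltab : a < b)
    (abI : `[a, b]%classic `<=` I)
    (mu_in : mu \in [:: -1; 1; 0; - 'i%C; 'i%C])
    (E_compl : complementary I E)
    (alpha01 : 0 < alpha < 1) (beta01 : 0 < beta < 1) (ab_gt1 : 1 < alpha + beta)
    (C1Xq : C1_field Xq) (C1Xp : C1_field Xp) :
  (hamiltonian_system Xq Xp <->
     selfadjoint_derivative I mu E Xq Xp a b alpha beta) /\
  (hamiltonian_system Xq Xp -> is_hamiltonian_of Xq Xp (explicit_H Xq Xp)).
Proof.
have sa := @selfadjoint_integrability R d I a b mu E alpha beta Xq Xp openI ltab abI E_compl
  alpha01 beta01.
have ham : hamiltonian_system Xq Xp <-> integrability Xq Xp.
  split; first exact: hamiltonian_integrability.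
  by move=> h; exists (explicit_H Xq Xp); exact: explicit_H_hamiltonian.
split; first exact: iff_trans ham (iff_sym sa).
by move=> /ham; exact: explicit_H_hamiltonian.
Qed.
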